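(* Let $d\geq 2$ and $L\geq 6$ be integers, and let $\boldsymbol\sigma=(\sigma_n\colon\Lambda_d^*\to\Lambda_d^* )_{n\in\mathbb N}$ be the directive sequence of glued substitutions $\sigma_n=\Gamma\big(\zeta_{L^{2^{i+1}}}^{(n+1)2^{d-i}}\colon i=0,\ldots,d-1\big)$, that is, $$\sigma_n(a_i)=\kappa\big(\zeta_{L^{2^{i+1}}}^{(n+1)2^{d-i}}(a_i)\big),\qquad \sigma_n(b_i)=\kappa\big(\zeta_{L^{2^{i+1}}}^{(n+1)2^{d-i}}(b_i)\big)\qquad (i\in\{0,\ldots,d-1\}).$$ Let $\mu_0,\ldots,\mu_{d-1}$ be the $d$ ergodic measures of $(X_{\boldsymbol\sigma},S)$, indexed as described in the context. Then for every $i\in\{0,\ldots,d-1\}$, $$\delta_{\mu_i}=\frac{L^{2^{i+1}}-1}{L^{2^{i+1}}+1},$$ and the partial rigidity sequence is $(h^{(n)})_{n\in\mathbb N}$, that is, $\liminf_{n\to\infty}\mu_i(A\cap S^{-h^{(n)}}A)\geq\delta_{\mu_i}\mu_i(A)$ for every measurable $A$ and every $i$.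
   Context: Partial rigidity: for a measure preserving system $(X,\mathcal X,\mu,T)$, $\delta>0$ is a constant of partial rigidity for an increasing sequence of integers $(n_k)$ if $\liminf_{k\to\infty}\mu(A\cap T^{-n_k}A)\geq\delta\mu(A)$ for every measurable $A$. The partial rigidity rate $\delta_\mu$ is the supremum of all such $\delta>0$ over all sequences ($0$ if there are none). Alphabets: $\mathcal A_i=\{a_i,b_i\}$ for $i\in\{0,\ldots,d-1\}$ are pairwise disjoint two-letter alphabets and $\Lambda_d=\bigcup_{i=0}^{d-1}\mathcal A_i$. For an integer $M\ge 2$, $\zeta_M$ denotes the morphism $a\mapsto a^{M-1}b$, $b\mapsto b^{M-1}a$ on $\{a,b\}^*$; the same symbol denotes its copy on $\mathcal A_i^*$ obtained by replacing $a,b$ by $a_i,b_i$. Gluing: $\kappa\colon\Lambda_d^*\to\Lambda_d^*$ changes only the last letter of a (nonempty) word: $\kappa(ua_i)=ua_{i+1}$, $\kappa(ub_i)=ub_{i+1}$, with index modulo $d$. For substitutions $\tau_i\colon\mathcal A_i^*\to\mathcal A_i^*$, $\Gamma(\tau_0,\ldots,\tau_{d-1})\colon\Lambda_d^*\to\Lambda_d^*$ is the morphism $a_i\mapsto\kappa(\tau_i(a_i))$, $b_i\mapsto\kappa(\tau_i(b_i))$. $\mathcal S$-adic subshifts: for $\boldsymbol\sigma=(\sigma_n\colon A_{n+1}^*\to A_n^* )_{n\in\mathbb N}$, $\mathbb N=\{0,1,\ldots\}$, put $\sigma_{[n,N)}=\sigma_n\circ\cdots\circ\sigma_{N-1}$;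 $\mathcal L^{(n)}(\boldsymbol\sigma)$ is the set of words occurring in some $\sigma_{[n,N)}(c)$, $c\in A_N$, $N>n$; $X^{(n)}_{\boldsymbol\sigma}$ is the set of $x\in A_n^{\mathbb Z}$ all of whose finite subwords lie in $\mathcal L^{(n)}(\boldsymbol\sigma)$; $X_{\boldsymbol\sigma}=X^{(0)}_{\boldsymbol\sigma}$; $S$ is the shift. Here all $\sigma_n$ have constant length, and $h^{(n)}=|\sigma_{[0,n)}|$ denotes the common length of the words $\sigma_{[0,n)}(c)$. Induced measures: for each invariant probability measure $\mu$ on $X_{\boldsymbol\sigma}$ and $n\in\mathbb N$, $\mu^{(n)}$ is the unique invariant probability measure on $X_{\boldsymbol\sigma}^{(n)}$ with $\mu=\frac1{h^{(n)}}\sum_{0\le k<h^{(n)}}(S^k\circ\sigma_{[0,n)})_*\mu^{(n)}$ (the measure induced by $\mu$ on the base $\sigma_{[0,n)}(X^{(n)}_{\boldsymbol\sigma})$). Indexing of the ergodic measures: $(X_{\boldsymbol\sigma},S)$ has exactly $d$ ergodic measures, and $\mu_i$ is the one for which $\lim_{n\to\infty}\mu_i^{(n)}([w])=\nu_i([w])$ for all $w\in\mathcal A_i^*$, where $\nu_i$ is the unique invariant measure of the substitution subshift generated by $\zeta_{L^{2^{i+1}}}$ on the alphabet $\mathcal A_i$. *)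

(* Defs.v *)
(* MathComp / MathComp-Analysis. *)
From HB Require Import structures.
From mathcomp Require Import all_boot all_order all_algebra.
From mathcomp Require Import all_classical all_reals all_analysis.
Import Order.TTheory GRing.Theory Num.Theory.
Import numFieldNormedType.Exports.

Set Implicit Arguments.
Unset Strict Implicit.
Unset Printing Implicit Defensive.

Local Open Scope classical_set_scope.
Local Open Scope ring_scope.

Section MeasurePreserving.
Context {R : realType} {disp : measure_display} {T : measurableType disp}.
Variables (f : T -> T) (mu : probability T R).

Definition invariant_measure : Prop :=
  forall A, measurable A -> mu (f @^-1` A) = mu A.

Definition ergodic_measure : Prop :=
  invariant_measure /\
  forall A, measurable A -> f @^-1` A = A -> mu A = 0%E \/ mu A = 1%E.

(* "Increasing" is strict: otherwise the constant sequence 0 would make every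
   system rigid. *)
Definition partial_rigidity_constant (n : nat -> nat) (delta : R) : Prop :=
  [/\ 0 < delta,
      {homo n : k l / (k < l)%N >-> (k < l)%N} &
      forall A, measurable A ->
        (delta%:E * mu A <=
           limn_einf (fun k => mu (A `&` iter (n k) f @^-1` A)))%E].

(* The set is bounded by 1 (take A := setT), so that [sup] is the genuine
   supremum, and [sup set0 = 0]. *)
Definition partial_rigidity_rate : R :=
  sup [set delta | exists n, partial_rigidity_constant n delta].

End MeasurePreserving.

Section FullShift.
Variable A : pointedType.

(* Product sigma-algebra on A^Z; for a finite alphabet this is the Borel
   sigma-algebra of the product topology. *)
Definition coordinate_sets : set (set (int -> A)) :=
  [set [set x : int -> A | x k = c] | k in [set: int] & c in [set: A]].

Definition full_shift : Type := g_sigma_algebraType coordinate_sets.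

HB.instance Definition _ := Measurable.on full_shift.

Definition left_shift (x : full_shift) : full_shift := fun j => x (j + 1).

Definition subword (x : full_shift) (k : int) (m : nat) : seq A :=
  mkseq (fun j => x (k + j%:Z)) m.

Definition cylinder (w : seq A) : set full_shift :=
  [set x | subword x 0 (size w) = w].

End FullShift.

(* A substitution A^* -> B^* is given by the images of the letters. *)
Definition morph {A B : Type} (tau : A -> seq B) (w : seq A) : seq B :=
  flatten (map tau w).

(* For tau of constant length h, tau(x) on A^Z, where tau(x_0) is placed on the
   coordinates 0, ..., h - 1. *)
Definition morph_bi {A B : pointedType} (tau : A -> seq B)
    (x : full_shift A) : full_shift B :=
  let h := size (tau point) in
  fun j => nth point (tau (x (j %/ h%:Z)%Z)) `|(j %% h%:Z)%Z|%N.

Section Sadic.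
Context {A : pointedType}.
Variable sigma : nat -> A -> seq A.

(* sigma_[n, N) = sigma_n \o ... \o sigma_(N - 1), on letters. *)
Definition subst_range (n N : nat) (c : A) : seq A :=
  foldr (fun m w => morph (sigma m) w) [:: c] (index_iota n N).

(* The letter [point] is arbitrary: only used for sigma_m of constant length. *)
Definition height (n : nat) : nat := size (subst_range 0 n point).

Definition language (n : nat) : set (seq A) :=
  [set w | exists N c, (n < N)%N /\ infix w (subst_range n N c)].

Definition sadic_shift (n : nat) : set (full_shift A) :=
  [set x | forall k m, language n (subword x k m)].

(* An invariant probability measure on a subshift X of A^Z is represented by
   the corresponding measure on A^Z, which gives mass 1 to X. *)
Definition invariant_on {R : realType} (X : set (full_shift A))
    (mu : probability (full_shift A) R) : Prop :=
  invariant_measure (@left_shift A) mu /\ mu X = 1%E.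

Definition ergodic_on {R : realType} (X : set (full_shift A))
    (mu : probability (full_shift A) R) : Prop :=
  ergodic_measure (@left_shift A) mu /\ mu X = 1%E.

Definition induced_measure {R : realType} (mu : probability (full_shift A) R)
    (n : nat) (mun : probability (full_shift A) R) : Prop :=
  invariant_on (sadic_shift n) mun /\
  forall B, measurable B ->
    mu B = (((height n)%:R^-1)%:E *
      \sum_(0 <= k < height n)
        pushforward mun (iter k (@left_shift A) \o morph_bi (subst_range 0 n)) B)%E.

End Sadic.

(* zeta_M on {a, b}, with a := false and b := true. *)
Definition zeta (M : nat) (c : bool) : seq bool := rcons (nseq M.-1 c) (~~ c).

Definition subst_pow {A : Type} (tau : A -> seq A) (k : nat) (c : A) : seq A :=
  iter k (morph tau) [:: c].

(* Lambda_d, with a_i := (i, false) and b_i := (i, true). The proof of 2 <= d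
   is only there to make the type nonempty. *)
Definition Lambda (d : nat) (_ : (2 <= d)%N) : Type := ('I_d * bool)%type.

HB.instance Definition _ d (hd : (2 <= d)%N) := Choice.on (Lambda hd).
HB.instance Definition _ d (hd : (2 <= d)%N) :=
  isPointed.Build (Lambda hd) (Ordinal (ltnW hd), false).

Section Gluing.
Variables (d : nat) (hd : (2 <= d)%N).

(* Copy on A_i of a word over {a, b}. *)
Definition in_copy (i : 'I_d) (w : seq bool) : seq (Lambda hd) :=
  map (fun c => (i, c)) w.

Definition next_letter (c : Lambda hd) : Lambda hd := (ordS c.1, c.2).

Definition kappa (w : seq (Lambda hd)) : seq (Lambda hd) :=
  if w is c :: w' then rcons (belast c w') (next_letter (last c w')) else [::].

Definition Gamma (tau : 'I_d -> bool -> seq bool) (c : Lambda hd) :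
    seq (Lambda hd) :=
  kappa (in_copy c.1 (tau c.1 c.2)).

Definition glued_directive (L n : nat) : Lambda hd -> seq (Lambda hd) :=
  Gamma (fun i =>
    subst_pow (zeta (L ^ (2 ^ i.+1))%N) (n.+1 * 2 ^ (d - i))%N).

End Gluing.

Arguments in_copy {d} hd i w.
Arguments glued_directive {d} hd L n c.

(* Main.v *)
(** Blocks are synchronized: [kappa] makes the copy index change exactly at the
end of a block (and possibly right after it), so block boundaries can be read
off locally and [mun n] is the average of the shifted images of [mun n.+1]
under [sigma_n]. Since the first letter of [sigma_n(c)] is [c], comparing a
rigidity inequality on the bases of the towers shows that a constant of partial
rigidity is at most [sup_(k >= 1) mun n {x_0 = x_k}] for every [n], while
[mun n {x_0 = x_1 = c} >= (delta - o(1)) mun n {x_0 = c}] makes [delta] a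
constant along the heights.

Write [e_n(k)] for [2 mun n {x_0 = x_k} - 1]. Up to the vanishing mass outside the
copy [i], [e_n] is obtained from [e_(n+1)] by iterating the map [renorm], which
describes how [zeta M] acts on autocorrelations. It keeps [e(0) = 1], contracts
[e(1)] to [rho = (M - 3) / (M + 1)], and multiplies by at most [(M - 2) / M] the
supremum norm at distances which are not multiples of the block length; at
multiples of the block length, [e_n(l_n k) = e_(n+1)(k)] exactly. Hence the
supremum over [k >= 1] of [e_n(k)] tends to [rho], and [(1 + rho) / 2] is
[(M - 1) / (M + 1)]. *)
Require Import Defs.
From HB Require Import structures.
From mathcomp Require Import all_boot all_order all_algebra.
From mathcomp Require Import all_classical all_reals all_analysis.
From mathcomp Require Import zify ring lra.
Import Order.TTheory GRing.Theory Num.Theory.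
Import numFieldNormedType.Exports.

Set Implicit Arguments.
Unset Strict Implicit.
Unset Printing Implicit Defensive.

Local Open Scope classical_set_scope.
Local Open Scope ring_scope.

(** * Measurable sets, shifts and morphisms *)

Section RealProbability.
Context {R : realType} {disp : measure_display} {T : measurableType disp}.
Variable P : probability T R.

Definition pr (A : set T) : R := fine (P A).

Lemma prE A : measurable A -> P A = (pr A)%:E.
Proof. by move=> mA; rewrite fineK// fin_num_measure. Qed.

Lemma pr_ge0 A : 0 <= pr A.
Proof. by rewrite fine_ge0. Qed.

Lemma pr_le1 A : measurable A -> pr A <= 1.
Proof. by move=> mA; rewrite -lee_fin -prE// probability_le1. Qed.

Lemma pr_setT : pr setT = 1.
Proof. by rewrite /pr probability_setT. Qed.

Lemma pr_set0 : pr set0 = 0.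
Proof. by rewrite /pr measure0. Qed.

Lemma pr_setC A : measurable A -> pr (~` A) = 1 - pr A.
Proof.
move=> mA; apply: EFin_inj.
by rewrite -prE ?probability_setC ?EFinB ?prE//; exact: measurableC.
Qed.

Lemma le_pr A B : measurable A -> measurable B -> A `<=` B -> pr A <= pr B.
Proof. by move=> mA mB AB; rewrite -lee_fin -!prE// le_measure ?inE. Qed.

Lemma le_prU A B N : measurable A -> measurable B -> measurable N ->
  A `<=` B `|` N -> pr A <= pr B + pr N.
Proof.
move=> mA mB mN AB; apply: (@le_trans _ _ (pr (B `|` N))).
  by apply: le_pr => //; exact: measurableU.
rewrite -lee_fin EFinD -!prE//; last exact: measurableU.
exact: measureU2.
Qed.

Lemma pr_setID A B : measurable A -> measurable B ->
  pr A = pr (A `&` B) + pr (A `&` ~` B).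
Proof.
move=> mA mB; apply: EFin_inj; rewrite EFinD -!prE//.
- rewrite -measureU//.
  + by rewrite -setIUr setUv setIT.
  + exact: measurableI.
  + by apply: measurableI => //; exact: measurableC.
  + by rewrite setIACA setICr setI0.
- by apply: measurableI => //; exact: measurableC.
- exact: measurableI.
Qed.

End RealProbability.

(** * Measurability of conditions on finitely many coordinates *)

Section Measurability.
Variable A : pointedType.
Hypothesis finA : finite_set [set: A].

Lemma measurable_cst (Q : Prop) : measurable [set x : full_shift A | Q].
Proof.
have [HQ|HQ] := pselect Q.
  by rewrite (_ : [set _ | _] = setT)//; apply/seteqP; split.
by rewrite (_ : [set _ | _] = set0)//; apply/seteqP; split.
Qed.

(** The alphabet is finite, so this is a finite union over the values of [x j]. Letting [F] depend
    on [x] as well allows coordinates to be frozen one after the other. *)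
Lemma measurable_coord (j : int) (F : A -> full_shift A -> Prop) :
  (forall c, measurable [set x | F c x]) ->
  measurable [set x : full_shift A | F (x j) x].
Proof.
move=> mF.
rewrite (_ : [set x | _] =
   \bigcup_(c in [set: A]) ([set x | x j = c] `&` [set x | F c x])).
  apply: fin_bigcup_measurable => // c _; apply: measurableI => //.
  by apply: sub_sigma_algebra; exists j => //; exists c.
apply/seteqP; split => [x Fx|x [c _ [/= <-]]//].
by exists (x j).
Qed.

Lemma measurable_subword (F : seq A -> full_shift A -> Prop) (k : int) (m : nat) :
  (forall w, measurable [set x | F w x]) ->
  measurable [set x : full_shift A | F (subword x k m) x].
Proof.
elim: m k F => [|m IHm] k F mF; first exact: mF.
rewrite (_ : [set x | _] = [set x | F (x k :: subword x (k + 1) m) x]).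
  apply: (@measurable_coord k (fun c x => F (c :: subword x (k + 1) m) x)) => c.
  exact: (IHm (k + 1) (fun w x => F (c :: w) x)).
apply/seteqP; split => x /=;
  rewrite /subword /mkseq -[iota 0 m.+1]/(0%N :: iota 1 m) (iotaDl 1 0) /=;
  by rewrite addr0 -map_comp (eq_map (g := fun j => x (k + 1 + j%:Z)))
    // => j /=; rewrite -addrA -PoszD.
Qed.

Lemma measurable_coord1 (j : int) (Q : A -> Prop) :
  measurable [set x : full_shift A | Q (x j)].
Proof.
by apply: (@measurable_coord j (fun c _ => Q c)) => c; exact: measurable_cst.
Qed.

Lemma measurable_coord2 (j k : int) (Q : A -> A -> Prop) :
  measurable [set x : full_shift A | Q (x j) (x k)].
Proof.
by apply: (@measurable_coord j (fun c x => Q c (x k))) => c; exact: measurable_coord1.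
Qed.

End Measurability.

(** The coordinate sets generate the sigma-algebra, so one coordinate at a time is enough. *)
Lemma measurable_preimage_shift (A B : pointedType)
    (f : full_shift A -> full_shift B) :
  (forall j c, measurable [set x | f x j = c]) ->
  forall C, measurable C -> measurable (f @^-1` C).
Proof.
move=> mf; have : measurable_fun setT f.
  apply: (@measurability _ _ _ _ setT f (@coordinate_sets B)).
    by [].
  move=> _ [_ [j _ [c _ <-]] <-]; rewrite setTI; exact: mf.
by move=> mfT C mC; rewrite -[_ @^-1` _]setTI; exact: mfT.
Qed.

Lemma int_block (N : nat) (j : int) : (0 < N)%N ->
  exists q : int, exists2 r : nat, (r < N)%N & j = q * N%:Z + r%:Z.
Proof.
move=> N0; exists (j %/ N%:Z)%Z; exists `|(j %% N%:Z)%Z|%N.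
  by rewrite -ltz_nat gez0_abs ?modz_ge0// ?ltz_pmod//; lia.
by rewrite gez0_abs ?modz_ge0//; [exact: divz_eq | lia].
Qed.

Section Shift.
Variable A : pointedType.
Implicit Types x : full_shift A.

Lemma iter_shiftE k x (j : int) : iter k (@left_shift A) x j = x (j + k%:Z).
Proof.
elim: k j => [|k IHk] j /=; first by rewrite addr0.
by rewrite /left_shift IHk -addrA -intS.
Qed.

Lemma iter_shiftD k l x :
  iter (k + l) (@left_shift A) x = iter l (@left_shift A) (iter k (@left_shift A) x).
Proof. by rewrite addnC iterD. Qed.

Lemma measurable_iter_shift k (B : set (full_shift A)) :
  measurable B -> measurable (iter k (@left_shift A) @^-1` B).
Proof.
apply: measurable_preimage_shift => j c.
rewrite (_ : [set x | _] = [set x : full_shift A | x (j + k%:Z) = c]).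
  by apply: sub_sigma_algebra; exists (j + k%:Z) => //; exists c.
by apply/seteqP; split => x /=; rewrite iter_shiftE.
Qed.

Context {R : realType}.
Variable P : probability (full_shift A) R.
Hypothesis Pinv : invariant_measure (@left_shift A) P.

Lemma pr_iter_shift k B : measurable B -> pr P (iter k (@left_shift A) @^-1` B) = pr P B.
Proof.
move=> mB; elim: k => [//|k IHk]; rewrite -IHk /pr.
congr fine; rewrite -(Pinv (measurable_iter_shift k mB)).
by congr (P _); apply/seteqP; split => x /=; rewrite -iterSr.
Qed.

End Shift.

(** * Morphisms of constant length on finite and bi-infinite words *)

Lemma morph_cat (A B : Type) (tau : A -> seq B) u v :
  morph tau (u ++ v) = morph tau u ++ morph tau v.
Proof. by rewrite /morph map_cat flatten_cat. Qed.

Lemma morph_comp (A B C : Type) (tau : B -> seq C) (rho : A -> seq B) w :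
  morph tau (morph rho w) = morph (fun c => morph tau (rho c)) w.
Proof.
elim: w => // c w IHw.
by rewrite -[morph rho (c :: w)]/(rho c ++ morph rho w) morph_cat IHw.
Qed.

Section Morphisms.
Variables (A B : pointedType) (tau : A -> seq B) (h : nat).
Hypothesis size_tau : forall c, size (tau c) = h.

Lemma size_morph w : size (morph tau w) = (size w * h)%N.
Proof.
elim: w => // c w IHw.
by rewrite -[morph tau (c :: w)]/(tau c ++ morph tau w) size_cat IHw size_tau.
Qed.

Lemma nth_morph b a w q r : (q < size w)%N -> (r < h)%N ->
  nth b (morph tau w) (q * h + r) = nth b (tau (nth a w q)) r.
Proof.
elim: w q => [|c w IHw] [|q]// qw rh;
  rewrite -[morph tau (c :: w)]/(tau c ++ morph tau w).
  by rewrite nth_cat size_tau mul0n add0n rh.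
rewrite nth_cat size_tau mulSn -addnA ltnNge leq_addr /= addKn.
exact: (IHw q).
Qed.

Hypothesis h_gt0 : (0 < h)%N.

Lemma morph_bi_block (x : full_shift A) (q : int) r : (r < h)%N ->
  morph_bi tau x (q * h%:Z + r%:Z) = nth point (tau (x q)) r.
Proof.
move=> rh; rewrite /morph_bi size_tau divzMDl ?modzMDl; last by lia.
by rewrite divz_small ?modz_small ?addr0//; lia.
Qed.

Lemma iter_shift_morph_bi q (x : full_shift A) :
  iter (q * h) (@left_shift B) (morph_bi tau x) = morph_bi tau (iter q (@left_shift A) x).
Proof.
apply/funext => j; rewrite iter_shiftE.
have [a [r rh ->]] := int_block j h_gt0.
rewrite morph_bi_block// iter_shiftE addrAC PoszM -mulrDl.
exact: morph_bi_block.
Qed.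

Lemma measurable_morph_bi (finA : finite_set [set: A]) (D : set (full_shift B)) :
  measurable D -> measurable (morph_bi tau @^-1` D).
Proof.
apply: measurable_preimage_shift => j c.
have [a [r rh ->]] := int_block j h_gt0.
rewrite (_ : [set x | _] = [set x : full_shift A | nth point (tau (x a)) r = c]).
  exact: (measurable_coord1 finA a (fun b => nth point (tau b) r = c)).
by apply/seteqP; split => x /=; rewrite morph_bi_block.
Qed.

End Morphisms.

(** * Towers *)

Section Directive.
Variables (A : pointedType) (sigma : nat -> A -> seq A) (len : nat -> nat).
Hypothesis size_sigma : forall n c, size (sigma n c) = len n.
Hypothesis len_gt0 : forall n, (0 < len n)%N.
Hypothesis head_sigma : forall n c, nth point (sigma n c) 0 = c.

Local Notation h := (height sigma).
Local Notation S k := (iter k (@left_shift A)).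
Local Notation T n := (morph_bi (subst_range sigma 0 n)).

Lemma foldr_morph s w :
  foldr (fun m w => morph (sigma m) w) w s =
  morph (fun c => foldr (fun m w => morph (sigma m) w) [:: c] s) w.
Proof.
elim: s => [|m s IHs] /=; last by rewrite IHs morph_comp.
by elim: w => // c w IHw; rewrite {1}IHw.
Qed.

(** In [subst_range] the outermost substitution is [sigma 0]; induction on [n] needs the innermost
    one, [sigma n], split off instead. *)
Lemma subst_range_recr n c :
  subst_range sigma 0 n.+1 c = morph (subst_range sigma 0 n) (sigma n c).
Proof.
rewrite /subst_range /index_iota !subn0 -addn1 iotaD foldr_cat /= add0n.
by rewrite /morph/= cats0 foldr_morph.
Qed.

Lemma size_subst_range n c : size (subst_range sigma 0 n c) = h n.
Proof.
suff {c} : exists k, forall c, size (subst_range sigma 0 n c) = k.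
  by move=> [k Hk]; rewrite /height !Hk.
elim: n => [|n [k Hk]]; first by exists 1%N.
exists (len n * k)%N => c; rewrite subst_range_recr.
by rewrite (size_morph Hk) size_sigma.
Qed.

Lemma height0 : h 0 = 1%N. Proof. by []. Qed.

Lemma heightS n : h n.+1 = (len n * h n)%N.
Proof.
by rewrite -(size_subst_range n.+1 point) subst_range_recr
  (size_morph (size_subst_range n)) size_sigma.
Qed.

Lemma height_gt0 n : (0 < h n)%N.
Proof. by elim: n => // n IHn; rewrite heightS muln_gt0 len_gt0. Qed.

Lemma head_subst_range n c : nth point (subst_range sigma 0 n c) 0 = c.
Proof.
elim: n c => // n IHn c; rewrite subst_range_recr.
have := nth_morph (size_subst_range n) point point (w := sigma n c) (q := 0) (r := 0).
by rewrite mul0n => -> //; rewrite ?size_sigma ?IHn ?height_gt0 ?len_gt0.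
Qed.

(** Each [sigma n c] begins with [c], so every block of [T n y] begins with the letter it comes
    from. *)
Lemma morph_bi_subst_range_head n (y : full_shift A) (j : int) :
  T n y (j * (h n)%:Z) = y j.
Proof.
have := morph_bi_block (size_subst_range n) (height_gt0 n) y j (height_gt0 n).
by rewrite addr0 head_subst_range.
Qed.

Lemma morph_bi_subst_rangeS n (y : full_shift A) :
  T n.+1 y = T n (morph_bi (sigma n) y).
Proof.
apply/funext => j.
have [q [r rlt ->]] := int_block j (height_gt0 n.+1).
rewrite (morph_bi_block (size_subst_range n.+1) (height_gt0 n.+1))//.
have h0 := height_gt0 n.
have slt : (r %/ h n < len n)%N by rewrite ltn_divLR// -heightS.
have -> : q * (h n.+1)%:Z + r%:Z =
    (q * (len n)%:Z + (r %/ h n)%:Z) * (h n)%:Z + (r %% h n)%:Z.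
  by rewrite heightS PoszM mulrDl mulrA -addrA -PoszM -PoszD -divn_eq.
rewrite (morph_bi_block (size_subst_range n) h0) ?ltn_pmod//.
rewrite (morph_bi_block (size_sigma n) (len_gt0 n))//.
rewrite subst_range_recr {1}(divn_eq r (h n)).
by rewrite (nth_morph (size_subst_range n) point point) ?size_sigma ?ltn_pmod.
Qed.

Lemma iter_shift_subst_range n q (y : full_shift A) :
  S (q * h n) (T n y) = T n (S q y).
Proof. exact: (iter_shift_morph_bi (size_subst_range n) (height_gt0 n)). Qed.

(** * Recognizing the bases of the towers *)

Section Recognizability.
Hypothesis finA : finite_set [set: A].
Variable V : nat -> set (full_shift A).
Hypothesis mV : forall n, measurable (V n).
Hypothesis VP : forall n y q, (q < len n)%N ->
  V n (S q (morph_bi (sigma n) y)) <-> q = 0%N.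

(** For [k = h n] this is a left inverse of [T n], since it reads the first letters of the
    blocks. *)
Definition decimate (k : nat) (x : full_shift A) : full_shift A :=
  fun j => x (j * k%:Z).

Lemma measurable_decimate k B : measurable B -> measurable (decimate k @^-1` B).
Proof.
apply: measurable_preimage_shift => j c.
exact: (measurable_coord1 finA (j * k%:Z) (fun b => b = c)).
Qed.

Lemma decimate_subst_range n (y : full_shift A) : decimate (h n) (T n y) = y.
Proof. by apply/funext => j; exact: morph_bi_subst_range_head. Qed.

(* [x] is in the base of the tower of height [h n] iff all its successive
   desubstitutions below [n], which [decimate] reads off, start a block. *)
Fixpoint base (n : nat) : set (full_shift A) :=
  if n is m.+1 then base m `&` (decimate (h m) @^-1` V m) else setT.

Lemma measurable_base n : measurable (base n).
Proof.
elim: n => [|n IHn] /=; first exact: measurableT.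
by apply: measurableI => //; exact: measurable_decimate.
Qed.

(** For [s = q * h n + r], the point is [S r (T n (S q (sigma n y)))]. Membership in [base n] forces
    [r = 0] by induction; decimation then exposes [S q (sigma n y)] to the test [V n], which forces
    [q = 0]. *)
Lemma baseP n (y : full_shift A) s : (s < h n)%N ->
  base n (S s (T n y)) <-> s = 0%N.
Proof.
elim: n y s => [|n IHn] y s; first by rewrite height0 ltnS leqn0 => /eqP ->.
rewrite heightS => slt; have h0 := height_gt0 n.
rewrite (divn_eq s (h n)) iter_shiftD morph_bi_subst_rangeS iter_shift_subst_range.
have rlt : (s %% h n < h n)%N by rewrite ltn_pmod.
have qlt : (s %/ h n < len n)%N by rewrite ltn_divLR.
split => [[/= /(IHn _ _ rlt) ->]|].
  by rewrite /= decimate_subst_range => /(VP y qlt) ->.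
move/eqP; rewrite addn_eq0 muln_eq0 (gtn_eqF h0) orbF => /andP[/eqP q0 /eqP r0].
split; first by rewrite r0; apply/(IHn _ _ h0).
by rewrite r0 /= decimate_subst_range q0; apply/VP.
Qed.

Context {R : realType}.
Variables (mu : probability (full_shift A) R) (m : nat -> probability (full_shift A) R).
Hypothesis mP : forall n, induced_measure sigma mu n (m n).

Lemma measurable_tower n s B :
  measurable B -> measurable [set y | B (S s (T n y))].
Proof.
move=> mB.
apply: (measurable_morph_bi (size_subst_range n) (height_gt0 n) finA (D := S s @^-1` B)).
exact: measurable_iter_shift.
Qed.

Lemma pr_towers n B : measurable B ->
  pr mu B = (h n)%:R^-1 * \sum_(0 <= s < h n) pr (m n) [set y | B (S s (T n y))].
Proof.
move=> mB; apply: EFin_inj; rewrite -prE// (mP n).2// EFinM -sumEFin.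
by congr (_ * _)%E; apply: eq_bigr => s _; rewrite -prE//; exact: measurable_tower.
Qed.

(** Only the level [s = 0] of the tower meets [base n], so a single term of [pr_towers] survives. *)
Lemma pr_base n B : measurable B ->
  pr mu (base n `&` B) = (h n)%:R^-1 * pr (m n) [set y | B (T n y)].
Proof.
move=> mB; rewrite (pr_towers n); last exact: measurableI (measurable_base n) mB.
congr (_ * _); rewrite big_ltn ?height_gt0// big1_seq ?addr0.
  congr (pr _ _); apply/seteqP; split => y /=; first by case.
  by move=> By; split => //; apply/(@baseP n y 0 (height_gt0 n)).
move=> s /=; rewrite mem_index_iota => /andP[s0 sh].
rewrite (_ : [set y | _] = set0) ?pr_set0//; apply/seteqP; split => // y /=.
by move=> [/(baseP _ sh) s00]; rewrite s00 in s0.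
Qed.

(** The mass of the points of [base n] whose decimation lies in [B] is computed twice: from the
    tower of height [h n], which gives [pr (m n) B] up to a factor, and from the tower of height
    [h n.+1], whose levels in [base n] are the multiples of [h n]. *)
Lemma pr_induced_step n B : measurable B ->
  pr (m n) B = (len n)%:R^-1 *
    \sum_(0 <= q < len n) pr (m n.+1) [set y | B (S q (morph_bi (sigma n) y))].
Proof.
move=> mB; have h0 := height_gt0 n.
have mDB : measurable (decimate (h n) @^-1` B) by exact: measurable_decimate.
have hR : (h n)%:R != 0 :> R by rewrite pnatr_eq0 -lt0n.
apply: (@mulfI _ (h n)%:R^-1); first by rewrite invr_eq0.
have <- : pr mu (base n `&` decimate (h n) @^-1` B) = (h n)%:R^-1 * pr (m n) B.
  rewrite pr_base//; congr (_ * pr _ _).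
  by apply/seteqP; split => y /=; rewrite decimate_subst_range.
rewrite (pr_towers n.+1); last exact: measurableI (measurable_base n) mDB.
rewrite heightS natrM invfM [_^-1 * _^-1]mulrC -mulrA; congr (_ * (_ * _)).
rewrite big_nat_mul; apply: eq_big_seq => q _.
(* Among the levels from [q * h n] to [q.+1 * h n] excluded, only the lowest lies in [base n]. *)
rewrite -{1}[(q * h n)%N]add0n big_addn mulSn addnK big_ltn// big1_seq.
  rewrite [LHS]addr0 add0n; congr (pr _ _); apply/seteqP; split => y /=;
  rewrite morph_bi_subst_rangeS iter_shift_subst_range decimate_subst_range.
    by case.
  by move=> By; split => //; apply/(@baseP n _ 0 h0).
move=> r /=; rewrite mem_index_iota => /andP[r0 rh].
rewrite (_ : [set y | _] = set0) ?pr_set0//; apply/seteqP; split => // y /=.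
rewrite addnC iter_shiftD morph_bi_subst_rangeS iter_shift_subst_range.
by move=> [/(baseP _ rh) r00]; rewrite r00 in r0.
Qed.

End Recognizability.
End Directive.

(** * Upper bound on the constants of partial rigidity *)

Lemma limn_einf_geP (R : realType) (u : nat -> R) (l : R) :
  (l%:E <= limn_einf (fun k => (u k)%:E))%E <->
  (forall e, 0 < e -> exists N, forall k, (N <= k)%N -> l - e <= u k).
Proof.
rewrite limn_einf_lim (cvg_lim _ (@cvg_einfs_sup R (fun k => (u k)%:E)))//.
split=> [lu e e0|H].
  have : ((l - e)%:E < ereal_sup (range (einfs (fun k => (u k)%:E))))%E.
    by apply: lt_le_trans lu; rewrite lte_fin; lra.
  move=> /ereal_sup_gt[_ [N _ <-] Nlt]; exists N => k Nk.
  rewrite -lee_fin; apply: le_trans (ltW Nlt) _.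
  by apply: ereal_inf_lbound; exists k.
apply/lee_addgt0Pr => e e0; have [N HN] := H e e0.
rewrite -leeBlDr//; apply: (@le_trans _ _ (einfs (fun k => (u k)%:E) N)).
  by apply: le_ereal_inf_tmp => _ [k /= Nk <-]; rewrite -EFinB lee_fin HN.
by apply: ereal_sup_ubound; exists N.
Qed.

Section FirstLetter.
Variables (A : pointedType) (R : realType) (P : probability (full_shift A) R).
Hypothesis finA : finite_set [set: A].

Lemma sum_pr_letter (s : seq A) (B : set (full_shift A)) : uniq s -> measurable B ->
  \sum_(c <- s) pr P [set x | x 0 = c /\ B x] = pr P [set x | x 0 \in s /\ B x].
Proof.
move=> + mB; elim: s => [_|c s IHs /= /andP[cs us]].
  rewrite big_nil (_ : [set x | _] = set0) ?pr_set0//.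
  by apply/seteqP; split => x //=; rewrite in_nil; case.
have mI Q : measurable [set x : full_shift A | Q (x 0) /\ B x].
  by apply: measurableI mB; exact: measurable_coord1.
rewrite big_cons IHs// (@pr_setID _ _ _ _ [set x : full_shift A | x 0 \in c :: s /\ B x]
  [set x : full_shift A | x 0 = c]) //; [|exact: (mI (fun a => a \in c :: s))|].
  congr (_ + _); congr pr; apply/seteqP; split => x /=.
  - by move=> [<- Bx]; rewrite inE eqxx.
  - by move=> [[_ Bx] ->].
  - move=> [xs Bx]; split; first by rewrite inE xs orbT.
    by move=> xc; rewrite xc (negbTE cs) in xs.
  - by rewrite inE => -[[/orP[/eqP->//|]]].
exact: (measurable_coord1 finA 0 (fun a => a = c)).
Qed.

End FirstLetter.

Section Rigidity.
Variables (A : pointedType) (sigma : nat -> A -> seq A) (len : nat -> nat).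
Hypothesis size_sigma : forall n c, size (sigma n c) = len n.
Hypothesis len_gt1 : forall n, (1 < len n)%N.
Hypothesis head_sigma : forall n c, nth point (sigma n c) 0 = c.
Hypothesis finA : finite_set [set: A].
Variable V : nat -> set (full_shift A).
Hypothesis mV : forall n, measurable (V n).
Hypothesis VP : forall n y q, (q < len n)%N ->
  V n (iter q (@left_shift A) (morph_bi (sigma n) y)) <-> q = 0%N.
Context {R : realType}.
Variables (mu : probability (full_shift A) R) (m : nat -> probability (full_shift A) R).
Hypothesis mP : forall n, induced_measure sigma mu n (m n).

Local Notation h := (height sigma).
Local Notation S k := (iter k (@left_shift A)).
Local Notation T n := (morph_bi (subst_range sigma 0 n)).

Let len_gt0 n : (0 < len n)%N. Proof. exact: ltnW. Qed.
Let h_gt0 n : (0 < h n)%N. Proof. exact: (height_gt0 size_sigma). Qed.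
Let base_V := base sigma V.

(** A point of [base n] can return to it only after a multiple of [h n] steps, and the letters at
    the starts of the two blocks must then agree. *)
Lemma le_pr_base_return n c N : (0 < N)%N ->
  pr mu (base_V n `&` [set x | x 0 = c] `&`
         S N @^-1` (base_V n `&` [set x | x 0 = c])) <=
  (h n)%:R^-1 * (if (h n %| N)%N then
    pr (m n) [set y | y 0 = c /\ y 0 = y (N %/ h n)%:Z] else 0).
Proof.
move=> N0; have mb : measurable (base_V n) by exact: measurable_base.
have mc : measurable [set x : full_shift A | x 0 = c].
  exact: (measurable_coord1 finA 0 (fun a => a = c)).
have mbc := measurableI _ _ mb mc.
rewrite -setIA (pr_base size_sigma len_gt0 head_sigma finA mV VP mP); last first.
  by apply: measurableI => //; exact: measurable_iter_shift.
rewrite ler_pM2l ?invr_gt0 ?ltr0n//.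
have head0 (y : full_shift A) : T n y 0 = y 0.
  have := morph_bi_subst_range_head size_sigma len_gt0 head_sigma n y 0.
  by rewrite mul0r.
have rlt : (N %% h n < h n)%N by rewrite ltn_pmod.
have SN (y : full_shift A) : S N (T n y) = S (N %% h n) (T n (S (N %/ h n) y)).
  by rewrite {1}(divn_eq N (h n)) iter_shiftD (iter_shift_subst_range size_sigma).
case: ifPn => hN.
  apply: le_pr.
  - apply: (@measurable_tower A sigma len size_sigma len_gt0 finA n 0
      ([set x | x 0 = c] `&` S N @^-1` (base_V n `&` [set x | x 0 = c]))).
    by apply: measurableI => //; exact: measurable_iter_shift.
  - exact: (measurable_coord2 finA 0 _ (fun a b => a = c /\ a = b)).
  - move=> y /= [+ [_ +]]; rewrite SN (eqP hN) /= !head0 iter_shiftE add0r => ->.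
    by move=> ->.
rewrite (_ : [set y | _] = set0) ?pr_set0//; apply/seteqP; split => // y /=.
move=> [_ [+ _]]; rewrite SN => /(baseP size_sigma len_gt0 head_sigma VP _ rlt) r0.
by rewrite /dvdn r0 in hN.
Qed.

Lemma pr_base_letter n c :
  pr mu (base_V n `&` [set x | x 0 = c]) = (h n)%:R^-1 * pr (m n) [set y | y 0 = c].
Proof.
rewrite (pr_base size_sigma len_gt0 head_sigma finA mV VP mP); last first.
  exact: (measurable_coord1 finA 0 (fun a => a = c)).
congr (_ * pr _ _); apply/seteqP; split => y /=;
  by have := morph_bi_subst_range_head size_sigma len_gt0 head_sigma n y 0;
  rewrite mul0r => ->.
Qed.

(** The rigidity inequality is tested on [base n] cut according to the first letter. Summed over the
    letters, the masses give [1 / h n] and the returns at most [b / h n]. *)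
Lemma rigidity_constant_le n b (f : nat -> nat) delta : 0 <= b ->
  (forall k, (0 < k)%N -> pr (m n) [set y | y 0 = y k%:Z] <= b) ->
  partial_rigidity_constant (@left_shift A) mu f delta -> delta <= b.
Proof.
move=> b0 Hb [delta0 fincr Hf].
have [s0 Hs0] := (finite_seqP _).1 finA; pose s := undup s0.
have sP c : c \in s by rewrite mem_undup; have : [set` s0] c by rewrite -Hs0.
have us : uniq s by exact: undup_uniq.
have mB c : measurable (base_V n `&` [set x | x 0 = c]).
  apply: measurableI; first exact: measurable_base.
  exact: (measurable_coord1 finA 0 (fun a => a = c)).
pose u c N := pr mu (base_V n `&` [set x | x 0 = c] `&`
         S N @^-1` (base_V n `&` [set x | x 0 = c])).
have u_inf c e : 0 < e -> exists N, forall k, (N <= k)%N ->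
    delta * pr mu (base_V n `&` [set x | x 0 = c]) - e <= u c (f k).
  apply: (iffLR (limn_einf_geP _ _)).
  have := Hf _ (mB c); rewrite (prE _ (mB c)) -EFinM.
  congr (_ <= limn_einf _)%E; apply/funext => k.
  by rewrite prE//; apply: measurableI => //; exact: measurable_iter_shift.
have u_sum (s' : seq A) e : 0 < e -> exists N, forall k, (N <= k)%N ->
    \sum_(c <- s') (delta * pr mu (base_V n `&` [set x | x 0 = c]) - e) <=
    \sum_(c <- s') u c (f k).
  move=> e0; elim: s' => [|c s' [N HN]]; first by exists 0%N => k _; rewrite !big_nil.
  have [N' HN'] := u_inf c _ e0; exists (maxn N N') => k; rewrite geq_max => /andP[Nk N'k].
  by rewrite !big_cons lerD ?HN ?HN'.
have hR : 0 < (h n)%:R :> R by rewrite ltr0n.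
have u_le k : (0 < k)%N -> \sum_(c <- s) u c k <= (h n)%:R^-1 * b.
  move=> k0; apply: (@le_trans _ _ (\sum_(c <- s) (h n)%:R^-1 * (if (h n %| k)%N then
    pr (m n) [set y | y 0 = c /\ y 0 = y (k %/ h n)%:Z] else 0))).
    by apply: ler_sum => c _; exact: le_pr_base_return.
  rewrite -mulr_sumr ler_pM2l ?invr_gt0//.
  have [hk|hk] := boolP (h n %| k)%N; last by rewrite big1.
  have mE : measurable [set y : full_shift A | y 0 = y (k %/ h n)%:Z].
    exact: (measurable_coord2 finA 0 (k %/ h n)%:Z (fun a b => a = b)).
  rewrite (@sum_pr_letter A R (m n) finA s [set y | y 0 = y (k %/ h n)%:Z])//.
  have := Hb (k %/ h n)%N; rewrite divn_gt0// dvdn_leq// => /(_ isT).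
  by congr (pr _ _ <= _); apply/seteqP; split => y /=; [split|case].
have sum1 : \sum_(c <- s) pr mu (base_V n `&` [set x | x 0 = c]) = (h n)%:R^-1.
  under eq_bigr do rewrite pr_base_letter.
  rewrite -mulr_sumr -[RHS]mulr1 -(pr_setT (m n)); congr (_ * _).
  have := sum_pr_letter (m n) finA us (@measurableT _ _).
  rewrite (_ : [set x | x 0 \in s /\ _] = setT); last first.
    by apply/seteqP; split => x //= _; rewrite sP.
  move=> <-; apply: eq_bigr => c _; congr pr.
  by apply/seteqP; split => x /=; [split | case].
suff : delta * (h n)%:R^-1 <= (h n)%:R^-1 * b by rewrite mulrC ler_pM2l ?invr_gt0.
apply/ler_addgt0Pr => e e0.
(* The error is shared among the letters; the successor keeps the denominator positive. *)
have e'0 : 0 < e / (size s).+1%:R by rewrite divr_gt0.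
have [N HN] := u_sum s _ e'0.
have fge k : (k <= f k)%N by elim: k => // k IHk; apply: leq_ltn_trans IHk (fincr _ _ _).
(* The index [N.+1] makes the return time [f N.+1] positive, as [u_le] requires. *)
have := HN N.+1 (leqnSn N).
have fN0 : (0 < f N.+1)%N by apply: leq_trans (fge _).
move=> /le_trans/(_ (u_le _ fN0)).
rewrite sumrB -mulr_sumr sum1 big_const_seq count_predT iter_addr_0 lerBlDr.
move=> /le_trans; apply; rewrite lerD2l -[_ *+ size s]mulr_natr mulrAC ler_pdivrMr// ler_pM2l//.
by rewrite ler_nat.
Qed.

End Rigidity.

(** * Rigidity along the heights *)

Section LocalSets.
Variable A : pointedType.

Definition local_set (W : nat) (B : set (full_shift A)) :=
  forall x x', (forall j : int, - W%:Z <= j <= W%:Z -> x j = x' j) -> B x -> B x'.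

Lemma le_local_set W W' B : (W <= W')%N -> local_set W B -> local_set W' B.
Proof. by move=> WW' lB x x' xx'; apply: lB => j jW; apply: xx'; lia. Qed.

Hypothesis finA : finite_set [set: A].

Lemma measurable_local_set W B : local_set W B -> measurable B.
Proof.
move=> lB.
pose Q (w : seq A) := exists2 x, B x & subword x (- W%:Z) (W + W).+1 = w.
rewrite (_ : B = [set x | Q (subword x (- W%:Z) (W + W).+1)]).
  apply: (@measurable_subword A finA (fun w _ => Q w)) => w.
  exact: measurable_cst.
apply/seteqP; split => [x Bx|x [x' Bx' xx']]; first by exists x.
apply: lB Bx' => j jW; have jW' : (absz (j + W%:Z)%R < (W + W).+1)%N by lia.
have := congr1 (fun w => nth point w (absz (j + W%:Z))) xx'.
rewrite !nth_mkseq// (_ : - W%:Z + _ = j)//; lia.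
Qed.

Context {R : realType}.
Variable P : probability (full_shift A) R.

(** [N] is a small set covering the symmetric difference of [B] and [C]; naming it lets errors be
    propagated by inclusions alone. *)
Definition approx_local (B : set (full_shift A)) :=
  measurable B /\ forall e, 0 < e -> exists (C N : set (full_shift A)) W,
    [/\ local_set W C, measurable N, pr P N <= e & B `<=` C `|` N /\ C `<=` B `|` N].

Lemma approx_localC B : approx_local B -> approx_local (~` B).
Proof.
move=> [mB aB]; split; first exact: measurableC.
move=> e /aB[C [N [W [lC mN Ne [BC CB]]]]]; exists (~` C), N, W; split => //.
  by move=> x x' xx' nCx Cx'; apply/nCx/(lC _ _ _ Cx') => j /xx'.
by split => x nx; apply: contrapT => /not_orP[/contrapT x1 x2];
  [have [|] := CB _ x1|have [|] := BC _ x1].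
Qed.

Lemma approx_localU B B' : approx_local B -> approx_local B' -> approx_local (B `|` B').
Proof.
move=> [mB aB] [mB' aB']; split; first exact: measurableU.
move=> e e0; have e2 : 0 < e / 2 by lra.
have [C [N [W [lC mN Ne [BC CB]]]]] := aB _ e2.
have [C' [N' [W' [lC' mN' Ne' [BC' CB']]]]] := aB' _ e2.
exists (C `|` C'), (N `|` N'), (maxn W W'); split.
- move=> x x' xx' [Cx|Cx]; [left|right].
    exact: (le_local_set (leq_maxl W W') lC) xx' Cx.
  exact: (le_local_set (leq_maxr W W') lC') xx' Cx.
- exact: measurableU.
- have := le_prU P (measurableU _ _ mN mN') mN mN' (fun x => id); lra.
- split => x [].
  + by case/BC; [left; left|right; left].
  + by case/BC'; [left; right|right; right].
  + by case/CB; [left; left|right; left].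
  + by case/CB'; [left; right|right; right].
Qed.

(** By continuity from below a finite union misses at most [e / 2] of the mass, and that union is
    approximated within [e / 2]. *)
Lemma approx_local_bigcup (F : nat -> set (full_shift A)) :
  (forall k, approx_local (F k)) -> approx_local (\bigcup_k F k).
Proof.
move=> aF; have mU : measurable (\bigcup_k F k).
  by apply: bigcup_measurable => k _; exact: (aF k).1.
split => // e e0; have e2 : 0 < e / 2 by lra.
pose G n := \big[setU/set0]_(k < n.+1) F k.
have aG n : approx_local (G n).
  rewrite /G; elim: n.+1 => [|k IHk]; last by rewrite big_ord_recr; exact: approx_localU.
  rewrite big_ord0; split; first exact: measurable0.
  by move=> e' e'0; exists set0, set0, 0%N; split => //; rewrite pr_set0 ltW.
have GU : \bigcup_n G n = \bigcup_k F k by rewrite bigcup_bigsetU_bigcup.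
have : (P \o G) n @[n --> \oo] --> P (\bigcup_k F k).
  rewrite -GU; apply: nondecreasing_cvg_mu.
  - by move=> k; exact: (aG k).1.
  - by rewrite GU.
  - by move=> i j ij; apply/subsetPset; exact: subset_bigsetU.
rewrite (prE _ mU) => /fine_cvgP[_ /cvgrPdist_le/(_ _ e2)[n _ /(_ n (leqnn n))/= nP]].
have [C [N [W [lC mN Ne [GC CG]]]]] := (aG n).2 _ e2.
have mD : measurable (\bigcup_k F k `&` ~` G n).
  by apply: measurableI => //; apply: measurableC; exact: (aG n).1.
exists C, (N `|` (\bigcup_k F k `&` ~` G n)), W; split => //.
- exact: measurableU.
- have := le_prU P (measurableU _ _ mN mD) mN mD (fun x => id).
  have := pr_setID P mU (aG n).1.
  rewrite setIidr; last by rewrite -GU; exact: bigcup_sup.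
  by move: nP; rewrite -[fine (P (G n))]/(pr P (G n)) ler_norml; lra.
- split => x.
    move=> Ux; have [/GC[Cx|Nx]|nG] := pselect (G n x); first by left.
      by right; left.
    by right; right.
  move=> /CG[Gx|Nx]; last by right; left.
  by left; rewrite -GU; exists n.
Qed.

(** Approximable sets form a sigma-algebra, and the coordinate sets, being local, belong to it. *)
Lemma measurable_approx_local B : measurable B -> approx_local B.
Proof.
apply: smallest_sub; first split.
- split; first exact: measurable0.
  by move=> e e0; exists set0, set0, 0%N; split => //; rewrite pr_set0 ltW.
- by move=> D aD; rewrite setTD; exact: approx_localC.
- exact: approx_local_bigcup.
move=> _ [j _ [c _ <-]]; split.
  by apply: sub_sigma_algebra; exists j => //; exists c.
move=> e e0; exists [set x : full_shift A | x j = c], set0, `|j|%N; split => //.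
- by move=> x x' xx' /= <-; rewrite xx'//; lia.
- by rewrite pr_set0 ltW.
Qed.

End LocalSets.

(** This sum and the next count the tower levels so close to the bottom or the top that a window of
    radius [W] may leave the block. *)
Lemma sum_ltn_le (R : realDomainType) (W h : nat) :
  \sum_(0 <= s < h) ((s < W)%N%:R : R) <= W%:R.
Proof.
have -> : \sum_(0 <= s < h) ((s < W)%N%:R : R) = (minn h W)%:R.
  elim: h => [|h IHh]; first by rewrite big_nil min0n.
  by rewrite big_nat_recr//= IHh -natrD; congr _%:R; lia.
by rewrite ler_nat geq_minr.
Qed.

Lemma sum_gtn_le (R : realDomainType) (W h : nat) :
  \sum_(0 <= s < h) ((h <= s + W)%N%:R : R) <= W%:R.
Proof.
apply: le_trans (sum_ltn_le R W h); rewrite big_nat_rev le_eqVlt.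
apply/orP; left; apply/eqP; apply: eq_big_nat => s /andP[_ sh].
by congr ((_ : bool)%:R); lia.
Qed.

(** * From repeated letters to rigidity along the heights *)

Section RigiditySequence.
Variables (A : pointedType) (sigma : nat -> A -> seq A) (len : nat -> nat).
Hypothesis size_sigma : forall n c, size (sigma n c) = len n.
Hypothesis len_gt1 : forall n, (1 < len n)%N.
Hypothesis finA : finite_set [set: A].
Context {R : realType}.
Variables (mu : probability (full_shift A) R) (m : nat -> probability (full_shift A) R).
Hypothesis mu_inv : invariant_measure (@left_shift A) mu.
Hypothesis mP : forall n, induced_measure sigma mu n (m n).
Variable delta : R.
Hypothesis delta01 : 0 < delta <= 1.
(** [N] has to be uniform in [a]: the letters selected by a local set at a given level vary with
    [n]. *)
Hypothesis repeat_ge : forall e, 0 < e -> exists N, forall n, (N <= n)%N ->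
  forall a : A -> Prop, delta * pr (m n) [set y | a (y 0)] - e <=
    pr (m n) [set y | a (y 0) /\ y 0 = y 1].

Local Notation h := (height sigma).
Local Notation S k := (iter k (@left_shift A)).
Local Notation T n := (morph_bi (subst_range sigma 0 n)).

Let len_gt0 n : (0 < len n)%N. Proof. exact: ltnW. Qed.
Let h_gt0 n : (0 < h n)%N. Proof. exact: (height_gt0 size_sigma). Qed.

Lemma height_lt : {homo h : k l / (k < l)%N >-> (k < l)%N}.
Proof.
apply: homo_ltn => [x y z|n]; first exact: ltn_trans.
by rewrite (heightS size_sigma) ltn_Pmull.
Qed.

Lemma height_ge n : (n <= h n)%N.
Proof. by elim: n => // n IHn; apply: leq_ltn_trans IHn (height_lt _). Qed.

(** At a level at distance at least [W] from both ends, [B] sees a single block, hence only the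
    letter [y 0]. Shifting by [h n] replaces [y 0] by [y 1], so a repeated letter gives a return to
    [B]. *)
Lemma local_tower_return W B n s e : local_set W B ->
  (forall a : A -> Prop, delta * pr (m n) [set y | a (y 0)] - e <=
    pr (m n) [set y | a (y 0) /\ y 0 = y 1]) ->
  (W <= s)%N -> (s + W < h n)%N ->
  delta * pr (m n) [set y | B (S s (T n y))] - e <=
  pr (m n) [set y | B (S s (T n y)) /\ B (S (h n) (S s (T n y)))].
Proof.
move=> lB Hn Ws sW; pose a c := exists2 y : full_shift A, y 0 = c & B (S s (T n y)).
have aP y : B (S s (T n y)) <-> a (y 0).
  split=> [By|[y' yy']]; first by exists y.
  apply: lB => j jW; rewrite !iter_shiftE.
  have -> : j + s%:Z = 0 * (h n)%:Z + (absz (j + s%:Z))%:Z by lia.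
  have jh : (absz (j + s%:Z)%R < h n)%N by lia.
  by rewrite !(morph_bi_block (size_subst_range size_sigma n) (h_gt0 n))// yy'.
have SP y : S (h n) (S s (T n y)) = S s (T n (S 1 y)).
  by rewrite -iter_shiftD addnC iter_shiftD -{1}[h n]mul1n
    (iter_shift_subst_range size_sigma).
rewrite (_ : [set y | B _] = [set y | a (y 0)]); last first.
  by apply/seteqP; split => y /=; rewrite aP.
apply: le_trans (Hn a) _; apply: le_pr.
- exact: (measurable_coord2 finA 0 1 (fun c c' => a c /\ c = c')).
- apply: (@measurable_tower A sigma len size_sigma len_gt0 finA n s
    (B `&` S (h n) @^-1` B)).
  have mB := measurable_local_set finA lB.
  by apply: measurableI => //; exact: measurable_iter_shift.
- by move=> y /= [ay y01]; rewrite SP !aP iter_shiftE -y01.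
Qed.

Lemma local_set_return W B e : local_set W B -> 0 < e ->
  exists N, forall n, (N <= n)%N ->
    delta * pr mu B - e <= pr mu (B `&` S (h n) @^-1` B).
Proof.
move=> lB e0; have e2 : 0 < e / 2 by lra.
have mB := measurable_local_set finA lB.
have [N HN] := repeat_ge e2.
(* The [W + W] exceptional levels will be a proportion at most [e / 2] of all, as [n <= h n]. *)
have [N' HN'] : exists N', forall n, (N' <= n)%N -> (W + W)%:R <= e / 2 * n%:R.
  exists (Num.bound ((W + W)%:R / (e / 2))) => n Nn.
  rewrite mulrC -ler_pdivrMr//; apply: (le_trans (ltW (archi_boundP _))).
    by rewrite divr_ge0 ?ler0n ?ltW.
  by rewrite ler_nat.
exists (maxn N N') => n; rewrite geq_max => /andP[Nn N'n].
have hR : 0 < (h n)%:R :> R by rewrite ltr0n.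
have mBB : measurable (B `&` S (h n) @^-1` B).
  by apply: measurableI => //; exact: measurable_iter_shift.
rewrite !(pr_towers size_sigma len_gt0 finA mP n)//.
rewrite lerBlDr -(ler_pM2l hR) mulrDr mulrCA !mulrA divff ?gt_eqF// !mul1r.
rewrite mulfK ?gt_eqF// -lerBlDr.
(* The indicators make the summand nonpositive at the levels near the ends, where
   [local_tower_return] says nothing. *)
apply: (@le_trans _ _ (\sum_(0 <= s < h n)
  (delta * pr (m n) [set y | B (S s (T n y))] - e / 2
     - (s < W)%N%:R - (h n <= s + W)%N%:R))).
  rewrite !sumrB -mulr_sumr -!addrA lerD2l big_const_nat subn0 iter_addr_0.
  have := sum_ltn_le R W (h n); have := sum_gtn_le R W (h n).
  have := HN' n N'n; rewrite natrD.
  have : e / 2 * n%:R <= e / 2 * (h n)%:R by rewrite ler_pM2l// ler_nat height_ge.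
  rewrite -[_ *+ _]mulr_natr; lra.
apply: ler_sum => s _.
have d1 : delta * pr (m n) [set y | B (S s (T n y))] <= 1.
  have [d0 d1] := andP delta01.
  by rewrite mulr_ile1 ?pr_ge0 ?pr_le1 ?(ltW d0)//;
    exact: (measurable_tower size_sigma len_gt0).
have p0 : 0 <= pr (m n) [set y | (B `&` S (h n) @^-1` B) (S s (T n y))] by exact: pr_ge0.
have [sW|Ws] := ltnP s W.
  apply: le_trans p0; rewrite /=.
  by have : 0 <= (h n <= s + W)%N%:R :> R := ler0n _ _; lra.
have [hW|Wh] := leqP (h n) (s + W); first by apply: le_trans p0; rewrite /=; lra.
rewrite /= !subr0; exact: (local_tower_return lB (HN n Nn)).
Qed.

Lemma height_rigidity_constant : partial_rigidity_constant (@left_shift A) mu h delta.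
Proof.
have [d0 d1] := andP delta01.
split=> // [|B mB]; first exact: height_lt.
have -> : (fun k => mu (B `&` S (h k) @^-1` B)) =
          (fun k => (pr mu (B `&` S (h k) @^-1` B))%:E).
  apply/funext => k; rewrite prE//.
  by apply: measurableI => //; exact: measurable_iter_shift.
rewrite prE// -EFinM; apply/limn_einf_geP => e e0.
(* The error set is paid three times, once for [delta * pr mu B] and twice in the intersection (for
   [N] and its preimage, of equal mass); the fourth quarter is the error for [C]. *)
have e4 : 0 < e / 4 by lra.
have [C [N [W [lC mN Ne [BC CB]]]]] := (measurable_approx_local mu mB).2 _ e4.
have [K HK] := local_set_return lC e4.
have mC := measurable_local_set finA lC.
exists K => n /HK; have mS D : measurable D -> measurable (S (h n) @^-1` D).
  exact: measurable_iter_shift.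
have mI D : measurable D -> measurable (D `&` S (h n) @^-1` D).
  by move=> mD; apply: measurableI => //; exact: mS.
have := le_prU mu mB mC mN BC.
have : pr mu (C `&` S (h n) @^-1` C) <=
       pr mu (B `&` S (h n) @^-1` B) + pr mu (N `|` S (h n) @^-1` N).
  apply: le_prU; [exact: mI|exact: mI|by apply: measurableU => //; exact: mS|].
  by move=> x [/CB[Bx|Nx] /CB[Bx'|Nx']];
    [left|right; right|right; left|right; left].
have := le_prU mu (measurableU _ _ mN (mS _ mN)) mN (mS _ mN) (fun x => id).
rewrite (pr_iter_shift mu_inv (h n) mN).
have := pr_ge0 mu N => N0 H1 H2 H3 H4.
have : delta * pr mu B <= delta * pr mu C + delta * pr mu N.
  by rewrite -mulrDr ler_pM2l.
have : delta * pr mu N <= pr mu N by rewrite ler_piMl.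
lra.
Qed.

End RigiditySequence.

(** * Autocorrelations under [zeta] *)

Section Digits.
Variable M : nat.
Hypothesis M_ge5 : (5 <= M)%N.

Let M_gt0 : (0 < M)%N. Proof. exact: leq_trans M_ge5. Qed.

(* [zeta M] negates the last of [M] letters, so the letter at position [q] of
   [zeta M ^ p c] is [c] negated once for each of the [p] base-[M] digits of
   [q] equal to [M - 1]. *)
Fixpoint digit_flip (p q : nat) : bool :=
  if p is p'.+1 then (q %% M == M.-1)%N (+) digit_flip p' (q %/ M)%N else false.

Lemma digit_flipS p q b : (b < M)%N ->
  digit_flip p.+1 (q * M + b) = (b == M.-1) (+) digit_flip p q.
Proof. by move=> bM /=; rewrite modnMDl modn_small// divnMDl// divn_small ?addn0. Qed.

Lemma size_zeta c : size (zeta M c) = M.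
Proof. by rewrite size_rcons size_nseq prednK. Qed.

Lemma nth_zeta c q : (q < M)%N -> nth point (zeta M c) q = c (+) (q == M.-1).
Proof.
move=> qM; rewrite nth_rcons size_nseq nth_nseq.
have [q1|q1|_] := ltngtP q M.-1; last by rewrite addbT.
- by rewrite addbF.
- by exfalso; lia.
Qed.

Lemma size_subst_pow_zeta p c : size (subst_pow (zeta M) p c) = (M ^ p)%N.
Proof.
elim: p => // p IHp; rewrite /subst_pow iterS.
by rewrite (size_morph size_zeta) -/(subst_pow _ _ _) IHp expnSr.
Qed.

Lemma nth_subst_pow_zeta p c q : (q < M ^ p)%N ->
  nth point (subst_pow (zeta M) p c) q = c (+) digit_flip p q.
Proof.
elim: p q => [|p IHp] q; first by rewrite expn0 ltnS leqn0 => /eqP ->; rewrite addbF.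
rewrite expnSr => qM; have rM : (q %% M < M)%N by rewrite ltn_pmod.
have dM : (q %/ M < M ^ p)%N by rewrite ltn_divLR.
rewrite {1}(divn_eq q M) /subst_pow iterS -/(subst_pow _ _ _).
rewrite (nth_morph size_zeta point point) ?size_subst_pow_zeta//.
by rewrite IHp// nth_zeta//= -addbA [digit_flip _ _ (+) _]addbC.
Qed.

Context {R : realFieldType}.
Implicit Types (E : nat -> R) (p K : nat).

Definition flip_sign p q : R := (-1) ^+ digit_flip p q.

Definition last_sign (b : nat) : R := (-1) ^+ (b == M.-1).

Lemma flip_signS p q b : (b < M)%N ->
  flip_sign p.+1 (q * M + b) = last_sign b * flip_sign p q.
Proof. by move=> bM; rewrite /flip_sign digit_flipS// signr_addb. Qed.

Lemma last_sign1 b : b != M.-1 -> last_sign b = 1.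
Proof. by rewrite /last_sign => /negbTE ->. Qed.

Lemma last_signN1 : last_sign M.-1 = -1.
Proof. by rewrite /last_sign eqxx. Qed.

Lemma big_nat_mulD (n k : nat) (F : nat -> R) :
  \sum_(0 <= q < n * k) F q = \sum_(0 <= i < n) \sum_(0 <= j < k) F (i * k + j)%N.
Proof.
rewrite big_nat_mul; apply: eq_bigr => i _.
rewrite -{1}[(i * k)%N]add0n big_addn mulSn addnK.
by apply: eq_bigr => j _; rewrite addnC.
Qed.

(** Each digit contributes a factor [M - 2]: [M - 1] of its values have sign [1] and one has sign
    [-1]. *)
Lemma sum_flip_sign p : \sum_(0 <= q < M ^ p) flip_sign p q = (M%:R - 2) ^+ p.
Proof.
elim: p => [|p IHp]; first by rewrite expn0 big_nat1 expr0.
rewrite expnSr big_nat_mulD exprSr -IHp mulr_suml; apply: eq_big_nat => q _.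
under eq_big_nat => b bM do rewrite flip_signS//.
rewrite -mulr_suml mulrC; congr (_ * _).
rewrite -{1}(prednK M_gt0) big_nat_recr//= last_signN1.
rewrite (eq_big_nat _ _ (F2 := fun=> 1)); last first.
  by move=> b bM; rewrite last_sign1//; lia.
rewrite big_const_nat subn0 iter_addr_0 -{2}(prednK M_gt0) -[in RHS]natr1; lra.
Qed.

(* One-step renormalization of autocorrelations: if [x] is obtained from [y]
   by [zeta M] then the correlation of [x] at distance [K] is [renorm E K],
   where [E] is that of [y]. *)
Definition renorm E K : R :=
  if (K %% M == 0)%N then E (K %/ M)%N else
  ((M%:R - (K %% M)%:R - 2) * E (K %/ M)%N +
   ((K %% M)%:R - 2) * E (K %/ M).+1) / M%:R.

(** For [t > 0], adding [t] produces a carry for the last [t] digits [b] and none for the first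
    [M - t]. In each range exactly one product of signs is [-1]: at [b = M - 1 - t] without carry,
    at [b = M - 1] with carry. *)
Lemma sum_last_sign t (g : nat -> R) : (t < M)%N ->
  \sum_(0 <= b < M) last_sign b * last_sign ((b + t) %% M)%N * g ((b + t) %/ M)%N =
  if t == 0%N then M%:R * g 0%N
  else (M%:R - t%:R - 2) * g 0%N + (t%:R - 2) * g 1%N.
Proof.
case: t => [_|t tM] /=.
  under eq_big_nat => b bM.
    rewrite addn0 modn_small; last lia.
    rewrite divn_small; last lia.
    rewrite -signr_addb addbb expr0 mul1r; over.
  by rewrite big_const_nat subn0 iter_addr_0 mulr_natl.
have [s Ms] : exists s, M = (s.+1 + t.+1)%N by exists (M - t.+1).-1; lia.
rewrite (big_cat_nat (n := s.+1))//=; last by lia.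
congr (_ + _).
  rewrite big_nat_recr//= (eq_big_nat _ _ (F2 := fun=> g 0%N)); last first.
    move=> b bs; rewrite modn_small; last lia.
    rewrite divn_small; last lia.
    by rewrite !last_sign1 ?mul1r//; lia.
  rewrite modn_small; last lia.
  rewrite divn_small; last lia.
  rewrite last_sign1; last lia.
  rewrite (_ : (s + t.+1)%N = M.-1) ?last_signN1; last lia.
  rewrite big_const_nat subn0 iter_addr_0 -[_ *+ s]mulr_natl.
  have -> : (M%:R : R) = s%:R + 1 + t.+1%:R by rewrite Ms natrD -natr1.
  ring.
have -> : (s.+1 = 0 + s.+1)%N by lia.
rewrite big_addn (_ : (M - (0 + s.+1) = t.+1)%N); last lia.
have dm b : (b < M)%N -> ((b + (0 + s.+1) + t.+1) %% M = b)%N /\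
    ((b + (0 + s.+1) + t.+1) %/ M = 1)%N.
  move=> bM; rewrite (_ : b + _ + _ = 1 * M + b)%N; last lia.
  by rewrite modnMDl divnMDl// modn_small// divn_small.
rewrite big_nat_recr//= (eq_big_nat _ _ (F2 := fun=> g 1%N)); last first.
  move=> b bs; have [|-> ->] := dm b; first lia.
  by rewrite !last_sign1 ?mul1r//; lia.
have [|-> ->] := dm t; first lia.
rewrite [last_sign t]last_sign1; last lia.
rewrite (_ : (t + (0 + s.+1))%N = M.-1) ?last_signN1; last lia.
rewrite big_const_nat subn0 iter_addr_0 -[_ *+ t]mulr_natl -natr1.
ring.
Qed.

(** Induction on [p], splitting off the lowest digit [b] of the position. The sum over the other
    digits is the same correlation at distance [K %/ M] plus the carry, and [sum_last_sign]
    evaluates the sum over [b]. *)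
Lemma correlation_renorm p E K :
  \sum_(0 <= q < M ^ p) flip_sign p q * flip_sign p (q + K) * E ((q + K) %/ M ^ p)%N =
  (M ^ p)%:R * iter p renorm E K.
Proof.
have MR : (M%:R : R) != 0 by rewrite pnatr_eq0 -lt0n.
elim: p K => [|p IHp] K.
  by rewrite expn0 big_nat1 add0n divn1 /flip_sign /= expr0 !mul1r.
rewrite expnSr big_nat_mulD exchange_big/=.
have tM : (K %% M < M)%N by rewrite ltn_pmod.
rewrite (eq_big_nat _ _ (F2 := fun b => last_sign b * last_sign ((b + K %% M) %% M)%N *
  ((M ^ p)%:R * iter p renorm E (K %/ M + (b + K %% M) %/ M)%N))); last first.
  move=> b bM; rewrite -IHp mulr_sumr; apply: eq_big_nat => j _.
  have -> : (j * M + b + K =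
      (j + (K %/ M + (b + K %% M) %/ M)) * M + (b + K %% M) %% M)%N.
    rewrite {1}(divn_eq K M) !mulnDl -!addnA -(divn_eq (b + K %% M) M).
    by rewrite [(b + (_ + _))%N]addnCA.
  rewrite !flip_signS ?ltn_pmod//.
  rewrite [(M ^ p * M)%N]mulnC divnMA divnMDl// [(_ %% M %/ M)%N]divn_small ?ltn_pmod//.
  rewrite addn0; ring.
rewrite (sum_last_sign (fun c => (M ^ p)%:R * iter p renorm E (K %/ M + c)%N) tM).
rewrite [renorm (iter _ _ _) _]/renorm natrM; case: ifP => _; first by rewrite addn0; ring.
by rewrite addn0 addn1 -[RHS]mulrA [M%:R * (_ / _)]mulrC mulfVK//; ring.
Qed.

Lemma M_ge5R : 5 <= M%:R :> R. Proof. by rewrite ler_nat. Qed.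

(** With [t = K %% M] between [1] and [M - 1], the weights satisfy [|M - t - 2| + |t - 2| <= M - 2],
    with equality at both extremes. *)
Lemma renorm_le E K c : ~~ (M %| K)%N ->
  `|E (K %/ M)%N| <= c -> `|E (K %/ M).+1| <= c ->
  `|renorm E K| <= (M%:R - 2) / M%:R * c.
Proof.
move=> MK x y; rewrite /renorm -/(dvdn M K) (negbTE MK).
have M5 := M_ge5R.
have M0 : 0 < (M%:R : R) by lra.
have t1 : 1 <= (K %% M)%:R :> R by rewrite ler1n lt0n.
have t2 : (K %% M)%:R + 1 <= M%:R :> R by rewrite natr1 ler_nat ltn_pmod.
rewrite mulrAC normrM normfV (gtr0_norm M0) ler_pM2r ?invr_gt0//.
have c0 : 0 <= c := le_trans (normr_ge0 _) x.
apply: le_trans (ler_normD _ _) _; rewrite !normrM.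
apply: le_trans (lerD (ler_wpM2l (normr_ge0 _) x) (ler_wpM2l (normr_ge0 _) y)) _.
rewrite -mulrDl ler_wpM2r//.
by case: (ger0P (M%:R - _ - 2)) => a; case: (ger0P ((K %% M)%:R - 2)) => b; lra.
Qed.

(** Since [K >= M ^ p], the distance is still positive after [p] divisions, so [E 0] never enters
    and each step is an average or a contraction. *)
Lemma iter_renorm_le p E c K : (forall k, (0 < k)%N -> `|E k| <= c) ->
  (M ^ p <= K)%N -> `|iter p renorm E K| <= c.
Proof.
move=> Ec; elim: p K => [|p IHp] K; first exact: Ec.
rewrite expnSr => MK; have k0 : (M ^ p <= K %/ M)%N by rewrite leq_divRL.
have M5 := M_ge5R.
rewrite iterS; have [dK|nK] := boolP (M %| K)%N.
  by rewrite /renorm -/(dvdn M K) dK IHp.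
apply: le_trans (renorm_le nK (IHp _ k0) (IHp _ (leqW k0))) _.
have c0 : 0 <= c := le_trans (normr_ge0 _) (Ec 1%N isT).
by rewrite ler_piMl// ler_pdivrMr; lra.
Qed.

(** As long as [M] divides [K], [renorm] only divides the distance. The first nonzero digit supplies
    the factor of [renorm_le]. *)
Lemma iter_renorm_lt p E c K : (forall k, (0 < k)%N -> `|E k| <= c) ->
  (M ^ p <= K)%N -> ~~ (M ^ p %| K)%N ->
  `|iter p renorm E K| <= (M%:R - 2) / M%:R * c.
Proof.
move=> Ec; elim: p K => [|p IHp] K; first by rewrite dvd1n.
rewrite expnSr => MK nMK; have k0 : (M ^ p <= K %/ M)%N by rewrite leq_divRL.
rewrite iterS; have [dK|nK] := boolP (M %| K)%N; last first.
  by apply: renorm_le => //; apply: iter_renorm_le => //; exact: leqW.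
rewrite /renorm -/(dvdn M K) dK IHp//.
by rewrite -(divnK dK) dvdn_pmul2r in nMK.
Qed.

(** The fixed point of [x |-> (M - 3 - x) / M], the action of [renorm] on [E 1] when [E 0 = 1]. Its
    slope [-1 / M] is the contraction in [iter_renorm1]. *)
Definition rho1 : R := (M%:R - 3) / (M%:R + 1).

Lemma rho1_bounds : 0 < rho1 < 1.
Proof.
by have M5 := M_ge5R; apply/andP; split; [apply: divr_gt0|rewrite ltr_pdivrMr]; lra.
Qed.

Lemma iter_renorm0 p E : iter p renorm E 0 = E 0%N.
Proof. by elim: p => // p IHp; rewrite iterS /renorm mod0n div0n. Qed.

Lemma iter_renorm1 p E : E 0%N = 1 ->
  `|iter p renorm E 1 - rho1| = `|E 1%N - rho1| / (M ^ p)%:R.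
Proof.
move=> E0; have M5 := M_ge5R; elim: p => [|p IHp]; first by rewrite divr1.
have M0 : 0 < (M%:R : R) by lra.
have -> : iter p.+1 renorm E 1 - rho1 = - (M%:R^-1 * (iter p renorm E 1 - rho1)).
  rewrite iterS {1}/renorm modn_small ?divn_small; try lia.
  rewrite iter_renorm0 E0 /= /rho1; field.
  by apply/andP; split; lra.
by rewrite normrN normrM normfV (gtr0_norm M0) IHp expnS natrM invfM mulrCA.
Qed.

(** Multiples of [M] reduce to smaller [p], other [K > M] are handled by the contraction, and for
    [1 < K < M] the values at [0] and [1] determine the result. *)
Lemma iter_renorm_initial p E kappa K : E 0%N = 1 -> 0 <= kappa ->
  `|E 1%N - rho1| <= kappa -> (0 < K <= M ^ p)%N ->
  `|iter p renorm E K| <= rho1 + kappa.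
Proof.
move=> E0 k0 E1; have M5 := M_ge5R; have /andP[r0 r1] := rho1_bounds.
have M0 : 0 < (M%:R : R) by lra.
have rE : rho1 * (M%:R + 1) = M%:R - 3 by rewrite /rho1 mulfVK//; lra.
have near1 q : `|iter q renorm E 1 - rho1| <= kappa.
  rewrite iter_renorm1//; apply: le_trans E1; rewrite ler_pdivrMr ?ltr0n ?expn_gt0 ?M_gt0//.
  by rewrite ler_peMr// ler1n expn_gt0 M_gt0.
elim: p K => [|p IHp] K.
  rewrite expn0 => K1; rewrite (_ : K = 1%N); last lia.
  by move: E1; rewrite /= !ler_norml => /andP[e1 e2]; apply/andP; split; lra.
move=> /andP[K0 KM]; have [->|K1] := eqVneq K 1%N.
  by move: (near1 p.+1); rewrite !ler_norml => /andP[e1 e2]; apply/andP; split; lra.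
rewrite iterS; have [dK|nK] := boolP (M %| K)%N.
  rewrite /renorm -/(dvdn M K) dK; apply: IHp.
  by rewrite divn_gt0// (dvdn_leq K0 dK) /= -(leq_pmul2r M_gt0) divnK// -expnSr.
(* Strictness puts [(K %/ M).+1] within the range of the induction hypothesis as well. *)
have kp : (K %/ M < M ^ p)%N.
  rewrite ltn_divLR// -expnSr ltn_neqAle KM andbT.
  by apply: contraNneq nK => ->; rewrite dvdn_exp.
have [kk0|kk0] := posnP (K %/ M)%N; last first.
  apply: le_trans (renorm_le nK (IHp _ _) (IHp _ _)) _; [lia|lia|].
  by rewrite ler_piMl ?ler_pdivrMr//; lra.
(* The value is now [(M - K - 2 + (K - 2) * x) / M], with [x] within [kappa] of [rho1] and
   [K >= 2]. *)
have KM1 : (K < M)%N by rewrite ltnNge -divn_gt0// kk0.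
rewrite /renorm -/(dvdn M K) (negbTE nK) kk0 iter_renorm0 E0 modn_small//.
have t2 : 2 <= K%:R :> R by rewrite (ler_nat _ 2); lia.
have t3 : K%:R + 1 <= M%:R :> R by rewrite natr1 ler_nat.
rewrite normrM normfV (gtr0_norm M0) ler_pdivrMr//.
have := near1 p; move: (iter _ _ _ _) (K%:R) t2 t3 => x t t2 t3.
by rewrite !ler_norml => /andP[x1 x2]; apply/andP; split; nra.
Qed.

End Digits.

(** * The glued directive sequence *)

Section GluedLength.
Variables (d L : nat).
Hypothesis hL : (6 <= L)%N.

Definition zeta_base (i : 'I_d) : nat := (L ^ (2 ^ i.+1))%N.
Definition zeta_power (i : 'I_d) (n : nat) : nat := (n.+1 * 2 ^ (d - i))%N.
Definition glued_len (n : nat) : nat := (L ^ (n.+1 * 2 ^ d.+1))%N.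
Definition flip (i : 'I_d) (n q : nat) : bool :=
  digit_flip (zeta_base i) (zeta_power i n) q.

Lemma zeta_base_ge5 i : (5 <= zeta_base i)%N.
Proof.
apply: (@leq_trans (L ^ 1)); first by rewrite expn1 ltnW.
by rewrite leq_exp2l ?expn_gt0//; lia.
Qed.

(** The factors [2 ^ i.+1] and [2 ^ (d - i)] in the exponent multiply to [2 ^ d.+1], so all the
    copies get images of the same length. *)
Lemma zeta_base_expn i n : (zeta_base i ^ zeta_power i n)%N = glued_len n.
Proof.
rewrite -expnM /zeta_power mulnCA -expnD /glued_len; congr (L ^ (_ * 2 ^ _))%N.
by rewrite addSn subnKC// ltnW.
Qed.

(** Blocks have at least three letters, which [block_marker] inspects, and their lengths tend to
    infinity. *)
Lemma glued_len_gt n : (n.+2 < glued_len n)%N.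
Proof.
apply: (@leq_trans (L ^ n.+1)); last by rewrite leq_exp2l ?leq_pmulr ?expn_gt0//; lia.
elim: n => [|n IHn]; first by rewrite expn1; lia.
by rewrite expnS; nia.
Qed.

Lemma glued_len_gt1 n : (1 < glued_len n)%N.
Proof. by have := glued_len_gt n; lia. Qed.

Lemma glued_len_gt0 n : (0 < glued_len n)%N.
Proof. exact: ltnW (glued_len_gt1 n). Qed.

Lemma flip0 i n : flip i n 0 = false.
Proof.
rewrite /flip; elim: (zeta_power i n) => //= p IHp.
by rewrite mod0n div0n IHp addbF; have := zeta_base_ge5 i; lia.
Qed.

End GluedLength.

(** * Letters and block boundaries of the glued substitutions *)

Section Glued.
Variables (d : nat) (hd : (2 <= d)%N) (L : nat).
Hypothesis hL : (6 <= L)%N.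

Local Notation A := (Lambda hd).
Local Notation sigma := (glued_directive hd L).
Local Notation S k := (iter k (@left_shift A)).
Local Notation glued_len := (glued_len d L).
Local Notation flip := (flip L).
Local Notation glued_len_gt := (glued_len_gt d hL).
Local Notation glued_len_gt0 := (glued_len_gt0 d hL).

Lemma finite_Lambda : finite_set [set: A].
Proof. exact: (@finite_finset ('I_d * bool)%type). Qed.

Lemma nth_kappa (w : seq A) q : (q < size w)%N ->
  nth point (kappa w) q =
  if q == (size w).-1 then next_letter (nth point w q) else nth point w q.
Proof.
case: w => // c w; rewrite /kappa nth_rcons size_belast lastI.
by rewrite nth_rcons size_rcons size_belast ltnS /=; case: ltngtP.
Qed.

Lemma size_kappa (w : seq A) : size (kappa w) = size w.
Proof. by case: w => // c w; rewrite /kappa size_rcons size_belast. Qed.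

Lemma size_glued n c : size (sigma n c) = glued_len n.
Proof.
rewrite /glued_directive /Gamma size_kappa size_map size_subst_pow_zeta.
  exact: zeta_base_expn.
exact: zeta_base_ge5.
Qed.

Lemma nth_glued n (c : A) q : (q < glued_len n)%N ->
  nth point (sigma n c) q =
  (if q == (glued_len n).-1 then ordS c.1 else c.1, c.2 (+) flip c.1 n q).
Proof.
move=> qn; have szw : size (in_copy hd c.1 (subst_pow
    (zeta (L ^ 2 ^ c.1.+1)) (n.+1 * 2 ^ (d - c.1)) c.2)) = glued_len n.
  rewrite size_map size_subst_pow_zeta; first exact: zeta_base_expn.
  exact: zeta_base_ge5.
rewrite /glued_directive /Gamma nth_kappa szw//.
rewrite (nth_map point) ?nth_subst_pow_zeta ?size_subst_pow_zeta;
  rewrite -/(zeta_base _) -/(zeta_power _ _) ?zeta_base_expn ?zeta_base_ge5//.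
by case: ifP.
Qed.

Lemma head_glued n c : nth point (sigma n c) 0 = c.
Proof.
have := glued_len_gt n => ln; rewrite nth_glued; last lia.
rewrite (flip0 hL) addbF ifN; last lia.
by case: c.
Qed.

(* A position where the copy index changes, but did not change just before, is
   the last one of a block: the only other possible change occurs at the first
   position of a block, right after the change forced by [kappa]. *)
Definition block_marker : set (full_shift A) :=
  [set x | (x (-1)).1 <> (x (-2)).1 /\ (x (-2)).1 = (x (-3)).1].

Lemma measurable_block_marker : measurable block_marker.
Proof.
apply: (@measurable_coord _ finite_Lambda (-1)
  (fun a x => a.1 <> (x (-2)).1 /\ (x (-2)).1 = (x (-3)).1)) => a.
exact: (@measurable_coord2 _ finite_Lambda (-2) (-3) (fun b c => a.1 <> b.1 /\ b.1 = c.1)).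
Qed.

Lemma ordS_neq (i : 'I_d) : ordS i <> i.
Proof.
move=> /(congr1 val) /=; have := ltn_ord i.
rewrite leq_eqVlt => /predU1P[id|idd]; last by rewrite modn_small//; lia.
by rewrite id modnn; lia.
Qed.

(** For [q = 0] the three inspected letters end the previous block, where [kappa] forces the change.
    For [q = 1] that change lies between positions [-3] and [-2], and for [q >= 2] positions [-2]
    and [-1] lie inside one block before its last letter. *)
Lemma block_markerP n y q : (q < glued_len n)%N ->
  block_marker (S q (morph_bi (sigma n) y)) <-> q = 0%N.
Proof.
move=> qn; have ln := glued_len_gt n.
have copyE (a : int) r : (r < glued_len n)%N ->
    (morph_bi (sigma n) y (a * (glued_len n)%:Z + r%:Z)).1 =
    if r == (glued_len n).-1 then ordS (y a).1 else (y a).1.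
  by move=> rn; rewrite (morph_bi_block (size_glued n) (glued_len_gt0 n))// nth_glued.
rewrite /block_marker /= !iter_shiftE; case: q qn => [|[|q]] qn.
- rewrite (_ : -1 + _ = -1 * (glued_len n)%:Z + ((glued_len n).-1)%:Z); last lia.
  rewrite (_ : -2 + _ = -1 * (glued_len n)%:Z + ((glued_len n).-2)%:Z); last lia.
  rewrite (_ : -3 + _ = -1 * (glued_len n)%:Z + ((glued_len n).-2.-1)%:Z); last lia.
  rewrite !copyE; try lia.
  rewrite eqxx !ifN; try lia.
  by split => // _; split => //; exact: ordS_neq.
- rewrite (_ : -2 + _ = -1 * (glued_len n)%:Z + ((glued_len n).-1)%:Z); last lia.
  rewrite (_ : -3 + _ = -1 * (glued_len n)%:Z + ((glued_len n).-2)%:Z); last lia.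
  rewrite !copyE; try lia.
  rewrite eqxx ifN; last lia.
  by split => // -[_ /ordS_neq].
- rewrite (_ : -1 + _ = 0 * (glued_len n)%:Z + q.+1%:Z); last lia.
  rewrite (_ : -2 + _ = 0 * (glued_len n)%:Z + q%:Z); last lia.
  rewrite !copyE; try lia.
  rewrite !ifN; try lia.
  by split => // -[].
Qed.

Lemma iter_shift_glued n q k (y : full_shift A) :
  S q (morph_bi (sigma n) y) k%:Z =
  nth point (sigma n (y ((q + k) %/ glued_len n)%N%:Z)) ((q + k) %% glued_len n).
Proof.
rewrite iter_shiftE -PoszD addnC {1}(divn_eq (q + k) (glued_len n)) PoszD PoszM.
by rewrite (morph_bi_block (size_glued n)) ?ltn_pmod ?glued_len_gt0.
Qed.

End Glued.

(** * Asymptotics of the induced measures *)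

Lemma digit_flip_mod M p q : (0 < M)%N -> digit_flip M p (q %% M ^ p)%N = digit_flip M p q.
Proof.
move=> M0; elim: p q => // p IHp q /=.
by rewrite expnSr -modn_divl IHp modn_dvdm// dvdn_mull.
Qed.

Lemma expr_small (R : realType) (x : R) : 0 <= x < 1 ->
  forall e, 0 < e -> exists N, forall n, (N <= n)%N -> x ^+ n <= e.
Proof.
move=> /andP[x0 x1] e e0.
have : (fun n => x ^+ n) @ \oo --> (0 : R) by apply: cvg_expr; rewrite ger0_norm.
move=> /cvgrPdist_le/(_ _ e0)[N _ HN]; exists N => n /HN /=.
by rewrite sub0r normrN ger0_norm// exprn_ge0.
Qed.

Lemma mean_diff_le (R : realFieldType) (l : nat) (e : R) (F G : nat -> R) : (0 < l)%N ->
  (forall q, (q < l)%N -> `|F q - G q| <= e) ->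
  `|l%:R^-1 * (\sum_(0 <= q < l) F q) - l%:R^-1 * (\sum_(0 <= q < l) G q)| <= e.
Proof.
move=> l0 H; have lR : 0 < l%:R :> R by rewrite ltr0n.
rewrite -mulrBr -sumrB normrM normfV (gtr0_norm lR) mulrC ler_pdivrMr//.
apply: le_trans (ler_norm_sum _ _ _) _.
have -> : e * l%:R = \sum_(0 <= q < l) e.
  by rewrite big_const_nat subn0 iter_addr_0 mulr_natr.
by apply: ler_sum_nat => q /andP[_]; exact: H.
Qed.

Section Estimates.
Variables (d : nat) (hd : (2 <= d)%N) (L : nat).
Hypothesis hL : (6 <= L)%N.
Context {R : realType}.
Variable m : nat -> probability (full_shift (Lambda hd)) R.

Local Notation A := (Lambda hd).
Local Notation sigma := (glued_directive hd L).
Local Notation S k := (iter k (@left_shift A)).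
Local Notation len := (glued_len d L).

Hypothesis m_inv : forall n, invariant_measure (@left_shift A) (m n).
Hypothesis m_step : forall n B, measurable B ->
  pr (m n) B = (len n)%:R^-1 *
    \sum_(0 <= q < len n) pr (m n.+1) [set y | B (S q (morph_bi (sigma n) y))].

Variable i : 'I_d.

Local Notation M := (zeta_base L i).
Local Notation p n := (zeta_power i n).

Let M5 : (5 <= M)%N. Proof. exact: zeta_base_ge5. Qed.
Let M_gt0 : (0 < M)%N. Proof. exact: leq_trans M5. Qed.
Let len0 n : (0 < len n)%N. Proof. exact: glued_len_gt0. Qed.
Let finA : finite_set [set: A]. Proof. exact: finite_Lambda. Qed.

Definition outside n : R := pr (m n) [set x | (x 0).1 <> i].

Hypothesis outside_small : forall e, 0 < e -> exists N, forall n, (N <= n)%N -> outside n <= e.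

Lemma outside_ge0 n : 0 <= outside n. Proof. exact: pr_ge0. Qed.

Lemma pr_outside n (k : nat) : pr (m n) [set x | (x k%:Z).1 <> i] = outside n.
Proof.
have <- : pr (m n) (S k @^-1` [set x | (x 0).1 <> i]) = outside n.
  apply: (pr_iter_shift (m_inv n) k).
  exact: (measurable_coord1 finA 0 (fun a : A => a.1 <> i)).
by congr pr; apply/seteqP; split => x /=; rewrite iter_shiftE add0r.
Qed.

(** Comparing two conditions inside the copy [i] costs the mass where one of the two letters is
    outside; by invariance each contributes [outside n]. *)
Lemma le_pr_inside2 n (j : nat) (B C : A -> A -> Prop) :
  (forall a b, a.1 = i -> b.1 = i -> B a b -> C a b) ->
  pr (m n) [set y | B (y 0) (y j%:Z)] <= pr (m n) [set y | C (y 0) (y j%:Z)] + 2 * outside n.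
Proof.
move=> BC.
have mO (k : int) : measurable [set x : full_shift A | (x k).1 <> i].
  exact: (measurable_coord1 finA k (fun a : A => a.1 <> i)).
have mB := measurable_coord2 finA 0 j%:Z B.
have mC := measurable_coord2 finA 0 j%:Z C.
have mU := measurableU _ _ (mO 0) (mO j%:Z).
have := le_prU (m n) mU (mO 0) (mO j%:Z) (fun x => id).
rewrite (pr_outside n j) -/(outside n).
have : pr (m n) [set y | B (y 0) (y j%:Z)] <= pr (m n) [set y | C (y 0) (y j%:Z)] +
    pr (m n) ([set x : full_shift A | (x 0).1 <> i] `|` [set x : full_shift A | (x j%:Z).1 <> i]).
  apply: le_prU => // y /= By.
  have [y0|y0] := pselect ((y 0).1 = i); last by right; left.
  have [yj|yj] := pselect ((y j%:Z).1 = i); last by right; right.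
  by left; exact: BC.
lra.
Qed.

Lemma le_pr_inside1 n (B C : A -> Prop) : (forall a, a.1 = i -> B a -> C a) ->
  pr (m n) [set y | B (y 0)] <= pr (m n) [set y | C (y 0)] + outside n.
Proof.
move=> BC; apply: le_prU.
- exact: (measurable_coord1 finA 0 B).
- exact: (measurable_coord1 finA 0 C).
- exact: (measurable_coord1 finA 0 (fun a : A => a.1 <> i)).
- move=> y /= By; have [y0|y0] := pselect ((y 0).1 = i); last by right.
  by left; exact: BC.
Qed.

(* [match_bit] ignores the copy index: this makes its renormalization insensitive
   to the gluing, which only affects that index. *)
Definition match_letter n (k : nat) : R := 2 * pr (m n) [set x | x 0 = x k%:Z] - 1.
Definition match_bit n (k : nat) : R := 2 * pr (m n) [set x | (x 0).2 = (x k%:Z).2] - 1.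

Lemma match_letter_bit n k : `|match_letter n k - match_bit n k| <= 4 * outside n.
Proof.
have le1 : pr (m n) [set x | x 0 = x k%:Z] <= pr (m n) [set x | (x 0).2 = (x k%:Z).2].
  apply: le_pr.
  - exact: (measurable_coord2 finA 0 k%:Z (fun a b => a = b)).
  - exact: (measurable_coord2 finA 0 k%:Z (fun a b : A => a.2 = b.2)).
  - by move=> x /= ->.
have le2 : pr (m n) [set x | (x 0).2 = (x k%:Z).2] <=
    pr (m n) [set x | x 0 = x k%:Z] + 2 * outside n.
  apply: (@le_pr_inside2 n k (fun a b => a.2 = b.2) (fun a b => a = b)).
  by move=> [a1 a2] [b1 b2] /= -> -> ->.
by rewrite ler_norml /match_letter /match_bit; apply/andP; split; lra.
Qed.

Lemma match_letter_bounds n k : `|match_letter n k| <= 1.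
Proof.
have mE := measurable_coord2 finA 0 k%:Z (fun a b => a = b).
have := pr_ge0 (m n) [set x | x 0 = x k%:Z]; have := pr_le1 (m n) mE.
by rewrite /match_letter ler_norml; lra.
Qed.

Lemma match_bit_bounds n k : `|match_bit n k| <= 1.
Proof.
have mE := measurable_coord2 finA 0 k%:Z (fun a b : A => a.2 = b.2).
have := pr_ge0 (m n) [set x | (x 0).2 = (x k%:Z).2]; have := pr_le1 (m n) mE.
by rewrite /match_bit ler_norml; lra.
Qed.

Lemma match_bit0 n : match_bit n 0 = 1.
Proof.
rewrite /match_bit (_ : [set x | _] = setT) ?pr_setT; first by lra.
by apply/seteqP; split.
Qed.

(** Positions at such a distance have the same place in their blocks, and the letter at a given
    place determines the source letter because [ordS] is injective. Hence there is no error term. *)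
Lemma match_letter_mul n k : match_letter n (len n * k) = match_letter n.+1 k.
Proof.
have l0 := len0 n.
rewrite /match_letter m_step; last first.
  exact: (measurable_coord2 finA 0 (len n * k)%N%:Z (fun a b => a = b)).
congr (2 * _ - 1).
rewrite (eq_big_nat _ _ (F2 := fun=> pr (m n.+1) [set x | x 0 = x k%:Z])); last first.
  move=> q qn; congr pr; apply/seteqP.
  suff E (y : full_shift A) : S q (morph_bi (sigma n) y) 0 =
      S q (morph_bi (sigma n) y) (len n * k)%N%:Z <-> y 0 = y k%:Z.
    by split => y /=; rewrite E.
  rewrite (iter_shift_glued hL n q 0) iter_shift_glued// addn0.
  rewrite divn_small// modn_small// mulnC addnC divnMDl// divn_small// addn0.
  rewrite modnMDl modn_small//; split => [|->//].
  rewrite !nth_glued// => -[].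
  case: (y 0) (y k%:Z) => [a1 a2] [b1 b2] /=.
  move=> e1; have <- : a1 = b1.
    by move: e1; case: ifP => // _ /(can_inj (@ordSK d)).
  by move=> /addIb ->.
by rewrite big_const_nat subn0 iter_addr_0 -[X in _ * X]mulr_natl mulKf// pnatr_eq0 -lt0n.
Qed.

(** Inside the copy [i], the bit at place [q] of a block is the source bit negated according to
    [flip]. Each place therefore contributes a signed value of [match_bit n.+1], and
    [correlation_renorm] averages them. *)
Lemma match_bit_step n k :
  `|match_bit n k - iter (p n) (renorm M) (match_bit n.+1) k| <= 4 * outside n.+1.
Proof.
have l0 := len0 n; have lR : (len n)%:R != 0 :> R by rewrite pnatr_eq0 -lt0n.
have eb : match_bit n k = (len n)%:R^-1 * (\sum_(0 <= q < len n)
    (2 * pr (m n.+1) [set y | (S q (morph_bi (sigma n) y) 0).2 =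
                           (S q (morph_bi (sigma n) y) k%:Z).2] - 1)).
  rewrite /match_bit m_step; last first.
    exact: (measurable_coord2 finA 0 k%:Z (fun a b : A => a.2 = b.2)).
  rewrite sumrB -mulr_sumr big_const_nat subn0 iter_addr_0 mulrBr mulrCA.
  by rewrite mulVf.
have er : iter (p n) (renorm M) (match_bit n.+1) k = (len n)%:R^-1 *
   (\sum_(0 <= q < len n) flip_sign M (p n) q * flip_sign M (p n) (q + k) *
      match_bit n.+1 ((q + k) %/ len n)%N).
  have := correlation_renorm M5 (p n) (match_bit n.+1) k.
  by rewrite zeta_base_expn// => ->; rewrite mulKf.
rewrite eb er; apply: mean_diff_le => // q qn.
rewrite (_ : [set y | _] = [set y | (nth point (sigma n (y 0)) q).2 =
   (nth point (sigma n (y ((q + k) %/ len n)%N%:Z)) ((q + k) %% len n)).2]); last first.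
  apply/seteqP; split => y /=;
  by rewrite (iter_shift_glued hL n q 0) iter_shift_glued// addn0 (divn_small qn) (modn_small qn).
set j := ((q + k) %/ len n)%N; set r := ((q + k) %% len n)%N.
have rn : (r < len n)%N by rewrite ltn_pmod.
(* The sign depends only on the lowest [p n] digits, that is, on the place within the block. *)
have -> : flip_sign M (p n) (q + k) = flip_sign M (p n) r :> R.
  by rewrite /flip_sign /r -(zeta_base_expn L i n) digit_flip_mod.
rewrite /flip_sign -signr_addb -/(flip L i n q) -/(flip L i n r).
pose B a b := (nth point (sigma n a) q).2 = (nth point (sigma n b) r).2.
have BE a b : a.1 = i -> b.1 = i -> B a b <-> a.2 (+) b.2 = flip L i n q (+) flip L i n r.
  move=> ai bi; rewrite /B !nth_glued//= ai bi.
  by case: a.2; case: b.2; case: flip; case: flip; split.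
have := @le_pr_inside2 n.+1 j B (fun a b => a.2 (+) b.2 = flip L i n q (+) flip L i n r).
move=> /(_ (fun a b ai bi => (BE a b ai bi).1)) h1.
have := @le_pr_inside2 n.+1 j (fun a b => a.2 (+) b.2 = flip L i n q (+) flip L i n r) B.
move=> /(_ (fun a b ai bi => (BE a b ai bi).2)) h2.
have mE := measurable_coord2 finA 0 j%:Z (fun a b : A => a.2 = b.2).
rewrite -[X in pr _ X]/[set y : full_shift A | B (y 0) (y j%:Z)] /match_bit.
(* If exactly one of the two places negates, matching becomes the complementary event, which
   accounts for the sign [-1]. *)
case: (flip L i n q (+) flip L i n r) h1 h2.
  rewrite (_ : [set y : full_shift A | (y 0).2 (+) _ = true] =
     ~` [set y : full_shift A | (y 0).2 = (y j%:Z).2]).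
    by rewrite pr_setC// expr1 ler_norml => h1 h2; apply/andP; split; lra.
  by apply/seteqP; split => y /=; case: (y 0).2; case: (y j%:Z).2.
rewrite (_ : [set y : full_shift A | (y 0).2 (+) _ = false] =
   [set y : full_shift A | (y 0).2 = (y j%:Z).2]).
  by rewrite expr0 ler_norml => h1 h2; apply/andP; split; lra.
by apply/seteqP; split => y /=; case: (y 0).2; case: (y j%:Z).2.
Qed.

Definition pr_bit n (c : bool) : R := pr (m n) [set x | (x 0).2 = c].

Lemma pr_bitN n c : pr_bit n (~~ c) = 1 - pr_bit n c.
Proof.
rewrite /pr_bit -pr_setC; last exact: (measurable_coord1 finA 0 (fun a : A => a.2 = c)).
by congr pr; apply/seteqP; split => x /=; case: (x 0).2; case: c.
Qed.

(** The bias of the bit is multiplied by the mean sign over a block, [((M - 2) / M) ^ p n] by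
    [sum_flip_sign], up to the mass outside the copy. *)
Lemma pr_bit_balance n c :
  `|2 * pr_bit n c - 1| <= ((M%:R - 2) / M%:R) ^+ p n + 2 * outside n.+1.
Proof.
have l0 := len0 n; have lR : (len n)%:R != 0 :> R by rewrite pnatr_eq0 -lt0n.
have eb : 2 * pr_bit n c - 1 = (len n)%:R^-1 * (\sum_(0 <= q < len n)
    (2 * pr (m n.+1) [set y | (S q (morph_bi (sigma n) y) 0).2 = c] - 1)).
  rewrite /pr_bit m_step; last first.
    exact: (measurable_coord1 finA 0 (fun a : A => a.2 = c)).
  rewrite sumrB -mulr_sumr big_const_nat subn0 iter_addr_0 mulrBr mulrCA.
  by rewrite mulVf.
pose t := 2 * pr_bit n.+1 c - 1.
have es : ((M%:R - 2) / M%:R) ^+ p n * t =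
    (len n)%:R^-1 * (\sum_(0 <= q < len n) flip_sign M (p n) q * t).
  rewrite -mulr_suml -{2}(zeta_base_expn L i n) sum_flip_sign//.
  by rewrite expr_div_n -natrX zeta_base_expn; ring.
have M5R := M_ge5R M5 (R := R).
have t1 : `|((M%:R - 2) / M%:R) ^+ p n * t| <= ((M%:R - 2) / M%:R) ^+ p n.
  rewrite normrM ger0_norm; last by rewrite exprn_ge0// divr_ge0; lra.
  rewrite ler_piMr//; first by rewrite exprn_ge0// divr_ge0; lra.
  have := pr_ge0 (m n.+1) [set x | (x 0).2 = c].
  have := pr_le1 (m n.+1) (measurable_coord1 finA 0 (fun a : A => a.2 = c)).
  by rewrite /t /pr_bit ler_norml => *; apply/andP; split; lra.
rewrite -[2 * _ - 1](subrK (((M%:R - 2) / M%:R) ^+ p n * t)) addrC.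
apply: le_trans (ler_normD _ _) _; apply: lerD => //.
rewrite eb es; apply: mean_diff_le => // q qn.
pose B (a : A) := (nth point (sigma n a) q).2 = c.
rewrite (_ : [set y | _] = [set y | B (y 0)]); last first.
  apply/seteqP; split => y /=;
  by rewrite (iter_shift_glued hL n q 0) addn0 divn_small// modn_small.
have BE a : a.1 = i -> B a <-> a.2 = c (+) flip L i n q.
  by move=> ai; rewrite /B nth_glued//= ai; case: a.2; case: flip; case: (c); split.
have := @le_pr_inside1 n.+1 B (fun a => a.2 = c (+) flip L i n q).
move=> /(_ (fun a ai => (BE a ai).1)) h1.
have := @le_pr_inside1 n.+1 (fun a => a.2 = c (+) flip L i n q) B.
move=> /(_ (fun a ai => (BE a ai).2)) h2.
move: h1 h2; rewrite /t /flip_sign -/(flip L i n q) -/(pr_bit n.+1 (c (+) flip L i n q)).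
case: (flip L i n q).
  rewrite addbT pr_bitN expr1 => h1 h2; rewrite ler_norml; apply/andP; split; lra.
rewrite addbF expr0 => h1 h2; rewrite ler_norml; apply/andP; split; lra.
Qed.

Lemma match_bit1_near e : 0 < e ->
  exists N, forall n, (N <= n)%N -> `|match_bit n 1 - rho1 M| <= e.
Proof.
(* One half of [e] covers [4 * outside]; the other covers an initial deviation at most [2], divided
   by a block length at least [n >= 4 / e]. *)
move=> e0; have [|N HN] := @outside_small (e / 8); first by lra.
exists (maxn N (Num.bound (4 / e))) => n; rewrite geq_max => /andP[Nn nb].
have h1 := HN n.+1 (leqW Nn); have h2 := match_bit_step n 1.
have h3 := @iter_renorm1 _ M5 R (p n) _ (match_bit0 n.+1).
have h4 : `|match_bit n.+1 1 - rho1 M| / (M ^ p n)%:R <= e / 2.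
  rewrite zeta_base_expn// ler_pdivrMr ?ltr0n//.
  have /andP[r0 r1] := @rho1_bounds _ M5 R.
  have b1 := match_bit_bounds n.+1 1.
  have : `|match_bit n.+1 1 - rho1 M| <= 2.
    by move: b1; rewrite !ler_norml => /andP[? ?]; apply/andP; split; lra.
  move=> /le_trans; apply; have : 4 / e <= n%:R.
    apply: le_trans (ltW (archi_boundP _)) _; first by rewrite divr_ge0// ltW.
    by rewrite ler_nat.
  rewrite ler_pdivrMr// => ne; have : n%:R <= (len n)%:R :> R.
    by rewrite ler_nat; have := glued_len_gt d hL n; lia.
  nra.
rewrite -h3 in h4; move: h2 h4; rewrite !ler_norml => /andP[? ?] /andP[? ?].
by apply/andP; split; lra.
Qed.

(** Multiples of [len n] pass unchanged to level [n.+1] and a smaller distance. Other distances are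
    bounded by [iter_renorm_initial] below [len n] and by the contraction [iter_renorm_lt] above
    it. *)
Lemma match_letter_step gamma : 0 < gamma ->
  (exists N, forall n, (N <= n)%N -> forall k, (0 < k)%N ->
    `|match_letter n k| <= rho1 M + gamma) ->
  exists N, forall n, (N <= n)%N -> forall k, (0 < k)%N ->
    `|match_letter n k| <= rho1 M + (M%:R - 1) / M%:R * gamma.
Proof.
move=> g0 [N1 H1]; have M5R := M_ge5R M5 (R := R).
have M0 : 0 < M%:R :> R by lra.
pose e := gamma / M%:R / 16; have e0 : 0 < e by rewrite /e !divr_gt0.
have ge : gamma = 16 * (M%:R * e) by rewrite /e; field; lra.
have [N2 H2] := match_bit1_near e0.
have [N3 H3] := outside_small e0.
(* Strong induction on [k] with [n] general, since dividing [k] by [len n] raises the level. *)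
exists (maxn N1 (maxn N2 N3)) => n + k; elim: k {-2}k (leqnn k) n => [|b IHb] k kb n.
  by move=> _; move: kb; rewrite leqn0 => /eqP ->.
move=> Nn k0; move: (Nn); rewrite !geq_max => /and3P[n1 n2 n3].
have /andP[r0 r1] := @rho1_bounds _ M5 R.
have l0 := len0 n.
have [dk|ndk] := boolP (len n %| k)%N.
  rewrite -(divnK dk) mulnC match_letter_mul; apply: IHb.
  - rewrite -ltnS; apply: leq_trans kb; apply: ltn_Pdiv => //.
    exact: (glued_len_gt1 d hL n).
  - exact: leqW.
  - by rewrite divn_gt0// dvdn_leq.
have oS := H3 n.+1 (leqW n3); have o := H3 n n3.
have a1 := match_letter_bit n k; have a2 := match_bit_step n k.
(* The gain [2 * gamma / M = 32 * e] leaves the required [16 * e] after paying [4 * e] here and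
   [8 * e] for the comparisons [a1] and [a2]. *)
suff : `|iter (p n) (renorm M) (match_bit n.+1) k| <= rho1 M + gamma - 2 * (gamma / M%:R) + 4 * e.
  have gM : gamma / M%:R = 16 * e by rewrite ge; field; lra.
  have -> : (M%:R - 1) / M%:R * gamma = gamma - gamma / M%:R by field; lra.
  rewrite gM.
  move: a1 a2; rewrite !ler_norml => /andP[? ?] /andP[? ?] /andP[? ?].
  by apply/andP; split; lra.
have gM : gamma / M%:R = 16 * e by rewrite ge; field; lra.
rewrite gM; have [kl|kl] := ltnP k (len n).
  apply: le_trans (iter_renorm_initial M5 (match_bit0 n.+1) (ltW e0) _ _) _.
  - exact: H2 (leqW n2).
  - by rewrite k0 zeta_base_expn// ltnW.
  - have : 5 * e <= M%:R * e by rewrite ler_pM2r.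
    by rewrite ge; lra.
rewrite -(zeta_base_expn L i n) in kl ndk.
apply: le_trans (iter_renorm_lt M5 (c := rho1 M + gamma + 4 * e) _ kl ndk) _.
  move=> k' k'0; have := H1 n.+1 (leqW n1) k' k'0; have := match_letter_bit n.+1 k'.
  by rewrite !ler_norml => /andP[? ?] /andP[? ?]; apply/andP; split; lra.
have -> : (M%:R - 2) / M%:R * (rho1 M + gamma + 4 * e) =
    (rho1 M + gamma + 4 * e) - 2 / M%:R * rho1 M - 2 * (gamma / M%:R) - 8 * e / M%:R.
  by field; lra.
rewrite gM; have : 0 <= 2 / M%:R * rho1 M :> R by apply: mulr_ge0; [apply: divr_ge0|]; lra.
have : 0 <= 8 * e / M%:R :> R by apply: divr_ge0; lra.
lra.
Qed.

(** Iterates the previous step from the trivial bound [1 <= rho1 M + 1] until the excess is below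
    [gamma]. *)
Lemma match_letter_le gamma : 0 < gamma ->
  exists N, forall n, (N <= n)%N -> forall k, (0 < k)%N -> `|match_letter n k| <= rho1 M + gamma.
Proof.
move=> g0; have M5R := M_ge5R M5 (R := R).
have M0 : 0 < M%:R :> R by lra.
pose x : R := (M%:R - 1) / M%:R.
have x0 : 0 < x by rewrite divr_gt0//; lra.
have x1 : x < 1 by rewrite ltr_pdivrMr//; lra.
have [|J /(_ J (leqnn J)) HJ] := @expr_small R x _ _ g0; first by rewrite x1 ltW.
have : exists N, forall n, (N <= n)%N -> forall k, (0 < k)%N ->
    `|match_letter n k| <= rho1 M + x ^+ J.
  elim: J {HJ} => [|J IHJ].
    exists 0%N => n _ k _; apply: le_trans (match_letter_bounds n k) _.
    by have /andP[r0 _] := @rho1_bounds _ M5 R; rewrite expr0; lra.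
  by rewrite exprS; apply: match_letter_step => //; rewrite exprn_gt0.
move=> [N HN]; exists N => n Nn k k0; apply: le_trans (HN n Nn k k0) _.
by rewrite lerD2l.
Qed.

(** By invariance both coordinates have the same bit frequencies, so the two mismatch probabilities
    agree. The two match probabilities then have a known sum and a known difference. *)
Lemma match_bit1E n c : 2 * pr (m n) [set x | (x 0).2 = c /\ (x 1).2 = c] =
  (1 + match_bit n 1) / 2 + (2 * pr_bit n c - 1).
Proof.
have mb (j : int) (b : bool) : measurable [set x : full_shift A | (x j).2 = b].
  exact: (measurable_coord1 finA j (fun a : A => a.2 = b)).
have m2 (b b' : bool) : measurable [set x : full_shift A | (x 0).2 = b /\ (x 1).2 = b'].
  exact: (measurable_coord2 finA 0 1 (fun a a' : A => a.2 = b /\ a'.2 = b')).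
have e1 b : pr_bit n b = pr (m n) [set x | (x 0).2 = b /\ (x 1).2 = b] +
                       pr (m n) [set x | (x 0).2 = b /\ (x 1).2 = ~~ b].
  rewrite /pr_bit (pr_setID _ (mb 0 b) (mb 1 b)); congr (_ + _); congr pr.
  by apply/seteqP; split => x /=; case: (x 0).2; case: (x 1).2; case: b=> /=; intuition congruence.
have e2 b : pr_bit n b = pr (m n) [set x | (x 0).2 = b /\ (x 1).2 = b] +
                       pr (m n) [set x | (x 0).2 = ~~ b /\ (x 1).2 = b].
  have -> : pr_bit n b = pr (m n) [set x | (x 1).2 = b].
    rewrite -[LHS](pr_iter_shift (m_inv n) 1 (mb 0 b)).
    by congr pr; apply/seteqP; split => x /=; rewrite iter_shiftE add0r.
  rewrite (pr_setID _ (mb 1 b) (mb 0 b)); congr (_ + _); congr pr;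
  by apply/seteqP; split => x /=; case: (x 0).2; case: (x 1).2; case: b=> /=; intuition congruence.
have e3 : pr (m n) [set x | (x 0).2 = (x 1).2] =
    pr (m n) [set x | (x 0).2 = c /\ (x 1).2 = c] +
    pr (m n) [set x | (x 0).2 = ~~ c /\ (x 1).2 = ~~ c].
  rewrite (pr_setID _ (measurable_coord2 finA 0 1 (fun a b : A => a.2 = b.2)) (mb 0 c)).
  congr (_ + _); congr pr;
  by apply/seteqP; split => x /=; case: (x 0).2; case: (x 1).2; case: c=> /=; intuition congruence.
have := e1 c; have := e2 (~~ c); have := pr_bitN n c; rewrite negbK /match_bit e3; lra.
Qed.

(** Both bits have frequency close to [1 / 2], so each letter of the copy [i] is followed by itself
    with conditional probability close to [(1 + rho1 M) / 2]. A general [a] is split over these two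
    letters. *)
Lemma repeat_ge_rho1 e : 0 < e -> exists N, forall n, (N <= n)%N ->
  forall a : A -> Prop, (1 + rho1 M) / 2 * pr (m n) [set y | a (y 0)] - e <=
    pr (m n) [set y | a (y 0) /\ y 0 = y 1].
Proof.
(* Each of the two letters costs [8 * h] and the outside [h], in all less than [20 * h]. *)
move=> e0; pose h := e / 20; have h0 : 0 < h by rewrite /h; lra.
have eh : e = 20 * h by rewrite /h; lra.
have /andP[r0 r1] := @rho1_bounds _ M5 R.
have [N1 H1] := match_bit1_near h0; have [N2 H2] := outside_small h0.
have M5R := M_ge5R M5 (R := R).
have [|N3 H3] := @expr_small R ((M%:R - 2) / M%:R) _ _ h0.
  by rewrite divr_ge0 ?ltr_pdivrMr//; lra.
exists (maxn N1 (maxn N2 N3)) => n; rewrite !geq_max => /and3P[n1 n2 n3] a.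
pose delta : R := (1 + rho1 M) / 2.
have dE : 2 * delta = 1 + rho1 M by rewrite /delta; lra.
have o := H2 n n2; have oS := H2 n.+1 (leqW n2).
have bal c : `|2 * pr_bit n c - 1| <= 3 * h.
  apply: le_trans (pr_bit_balance n c) _.
  have : ((M%:R - 2) / M%:R) ^+ p n <= h :> R.
    apply: H3; apply: leq_trans n3 _; rewrite /zeta_power.
    by rewrite (leq_trans (leqnSn n))// leq_pmulr// expn_gt0.
  lra.
have letter c : delta * pr (m n) [set y | a (y 0) /\ y 0 = (i, c)] - 8 * h <=
    pr (m n) [set y | a (y 0) /\ y 0 = y 1 /\ y 0 = (i, c)].
  have [ac|nac] := pselect (a (i, c)); last first.
    rewrite (_ : [set y | a (y 0) /\ y 0 = (i, c)] = set0) ?pr_set0; last first.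
      by apply/seteqP; split => y //= -[+ yc]; rewrite yc.
    by apply: le_trans (pr_ge0 _ _); lra.
  have h1 : pr (m n) [set y | a (y 0) /\ y 0 = (i, c)] <= pr_bit n c.
    apply: le_pr.
    - exact: (measurable_coord1 finA 0 (fun b => a b /\ b = (i, c))).
    - exact: (measurable_coord1 finA 0 (fun b : A => b.2 = c)).
    - by move=> y /= [_ ->].
  have h2 := @le_pr_inside2 n 1 (fun b b' => b.2 = c /\ b'.2 = c)
    (fun b b' => a b /\ b = b' /\ b = (i, c)).
  have {}h2 := h2 _; have := match_bit1E n c.
  have := bal c; have := H1 n n1; rewrite !ler_norml => /andP[? ?] /andP[? ?].
  have : delta * pr (m n) [set y | a (y 0) /\ y 0 = (i, c)] <= delta * pr_bit n c.
    by rewrite ler_wpM2l//; lra.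
  have : delta * (2 * pr_bit n c - 1) <= 3 * h.
    have [p0|p0] := lerP 0 (2 * pr_bit n c - 1); last by nra.
    by apply: (@le_trans _ _ (2 * pr_bit n c - 1)) => //; rewrite ler_piMl//; lra.
  have /h2 : forall b b' : A, b.1 = i -> b'.1 = i -> b.2 = c /\ b'.2 = c ->
      a b /\ b = b' /\ b = (i, c).
    by move=> [b1 b2] [b1' b2'] /= -> -> [-> ->].
  lra.
have mB (Q : A -> A -> Prop) : measurable [set y : full_shift A | Q (y 0) (y 1)].
  exact: (measurable_coord2 finA 0 1 Q).
have hf := letter false; have ht := letter true.
have k1 : pr (m n) [set y | a (y 0)] <= pr (m n) [set y | a (y 0) /\ y 0 = (i, false)] +
    pr (m n) [set y | a (y 0) /\ y 0 = (i, true)] + outside n.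
  have := @le_pr_inside1 n a (fun b => (a b /\ b = (i, false)) \/ (a b /\ b = (i, true))).
  have : forall b : A, b.1 = i -> a b -> (a b /\ b = (i, false)) \/ (a b /\ b = (i, true)).
    move=> [b1 []] /= -> ab; [right|left]; exact: conj ab erefl.
  move=> H /(_ H); move=> /le_trans; apply; rewrite lerD2r.
  apply: le_prU => //.
  - exact: (mB (fun b _ => (a b /\ b = (i, false)) \/ (a b /\ b = (i, true)))).
  - exact: (mB (fun b _ => (a b /\ b = (i, false)))).
  - exact: (mB (fun b _ => (a b /\ b = (i, true)))).
have k2 : pr (m n) [set y | a (y 0) /\ y 0 = y 1 /\ y 0 = (i, false)] +
    pr (m n) [set y | a (y 0) /\ y 0 = y 1 /\ y 0 = (i, true)] <=
    pr (m n) [set y | a (y 0) /\ y 0 = y 1].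
  rewrite (pr_setID _ (mB (fun b b' => a b /\ b = b')) (mB (fun b _ => b = (i, false)))).
  apply: lerD; apply: le_pr.
  - exact: (mB (fun b b' => a b /\ b = b' /\ b = (i, false))).
  - apply: measurableI; first exact: (mB (fun b b' => a b /\ b = b')).
    exact: (mB (fun b _ => b = (i, false))).
  - by move=> y /= [ay [y01 y0]]; exact: conj (conj ay y01) y0.
  - exact: (mB (fun b b' => a b /\ b = b' /\ b = (i, true))).
  - apply: measurableI; first exact: (mB (fun b b' => a b /\ b = b')).
    by apply: measurableC; exact: (mB (fun b _ => b = (i, false))).
  - by move=> y /= [ay [y01 y0]]; split; [exact: conj ay y01|rewrite y0 => -[]].
have k3 : delta * pr (m n) [set y | a (y 0)] <= delta * (
    pr (m n) [set y | a (y 0) /\ y 0 = (i, false)] +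
    pr (m n) [set y | a (y 0) /\ y 0 = (i, true)] + outside n).
  by rewrite ler_wpM2l//; lra.
have k4 : delta * outside n <= h.
  by apply: le_trans o; rewrite ler_piMl ?outside_ge0//; lra.
rewrite -/delta; lra.
Qed.

End Estimates.

(** * Concentration on one copy, and the value of the rate *)

(** The convergence is used for one-letter words: their two cylinders carry the whole mass of [nu],
    so the mass of the copy [i] tends to [1]. *)
Lemma outside_cvg0 (R : realType) (d : nat) (hd : (2 <= d)%N) (i : 'I_d)
    (m : nat -> probability (full_shift (Lambda hd)) R) (nu : probability (full_shift bool) R) :
  (forall w, m n (cylinder (in_copy hd i w)) @[n --> \oo] --> nu (cylinder w)) ->
  forall e, 0 < e -> exists N, forall n, (N <= n)%N -> outside m i n <= e.
Proof.
move=> Hlim e e0; have e2 : 0 < e / 2 by lra.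
have finb : finite_set [set: bool] by exact: finite_finset.
have finA := finite_Lambda hd.
pose f b n := pr (m n) [set x | x 0 = (i, b)].
pose g b := pr nu [set x | x 0 = b].
have cylE (A : pointedType) (c : A) : cylinder [:: c] = [set x : full_shift A | x 0 = c].
  by apply/seteqP; split => x; rewrite /cylinder /subword /=; [case|move=> <-].
have fg b : exists N, forall n, (N <= n)%N -> `|g b - f b n| <= e / 2.
  have := Hlim [:: b]; rewrite /= !cylE.
  rewrite [X in _ --> X]prE; last exact: (measurable_coord1 finb 0 (fun c => c = b)).
  by move=> /fine_cvgP[_ /cvgrPdist_le/(_ _ e2)[N _ HN]]; exists N => n /HN.
have [N1 H1] := fg false; have [N2 H2] := fg true.
exists (maxn N1 N2) => n; rewrite geq_max => /andP[/H1 + /H2].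
have g1 : g true = 1 - g false.
  rewrite /g -pr_setC; last exact: (measurable_coord1 finb 0 (fun c => c = false)).
  by congr pr; apply/seteqP; split => x /=; case: (x 0).
have f1 : f false n + f true n + outside m i n = 1.
  have mA (Q : Lambda hd -> Prop) : measurable [set x : full_shift (Lambda hd) | Q (x 0)].
    exact: (measurable_coord1 finA 0 Q).
  have -> : outside m i n = 1 - pr (m n) [set x | (x 0).1 = i].
    by rewrite -pr_setC; [|exact: (mA (fun a => a.1 = i))].
  rewrite (pr_setID _ (mA (fun a => a.1 = i)) (mA (fun a => a.2 = false))) /f.
  have -> : [set x : full_shift (Lambda hd) | (x 0).1 = i] `&`
      [set x : full_shift (Lambda hd) | (x 0).2 = false] =
      [set x : full_shift (Lambda hd) | x 0 = (i, false)].
    by apply/seteqP; split => x /=; case: (x 0) => a b /= [-> ->].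
  have -> : [set x : full_shift (Lambda hd) | (x 0).1 = i] `&`
      ~` [set x : full_shift (Lambda hd) | (x 0).2 = false] =
      [set x : full_shift (Lambda hd) | x 0 = (i, true)].
    by apply/seteqP; split => x /=; case: (x 0) => a [] /= [->]//.
  lra.
by rewrite !ler_norml => /andP[? ?] /andP[? ?]; lra.
Qed.

Theorem theorem4p8 (R : realType) (d L : nat) (hd : (2 <= d)%N) (hL : (6 <= L)%N)
    (mu : 'I_d -> probability (full_shift (Lambda hd)) R)
    (mun : 'I_d -> nat -> probability (full_shift (Lambda hd)) R)
    (nu : 'I_d -> probability (full_shift bool) R)
    (Hmu : forall i, ergodic_on (sadic_shift (glued_directive hd L) 0) (mu i))
    (Hmun : forall i n,
        induced_measure (glued_directive hd L) (mu i) n (mun i n))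
    (Hnu : forall i : 'I_d,
        invariant_on (sadic_shift (fun=> zeta (L ^ (2 ^ i.+1))%N) 0) (nu i))
    (Hlim : forall (i : 'I_d) (w : seq bool),
        mun i n (cylinder (in_copy hd i w)) @[n --> \oo]
          --> nu i (cylinder w)) :
  forall i : 'I_d,
    partial_rigidity_rate (@left_shift (Lambda hd)) (mu i) =
      ((L ^ (2 ^ i.+1))%N%:R - 1) / ((L ^ (2 ^ i.+1))%N%:R + 1) /\
    partial_rigidity_constant (@left_shift (Lambda hd)) (mu i)
      (height (glued_directive hd L))
      (partial_rigidity_rate (@left_shift (Lambda hd)) (mu i)).
Proof.
move=> i; set M := (L ^ 2 ^ i.+1)%N.
pose V (_ : nat) := @block_marker d hd.
have finA := finite_Lambda hd.
have szS n c : size (glued_directive hd L n c) = glued_len d L n by exact: size_glued.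
have len1 n : (1 < glued_len d L n)%N by exact: glued_len_gt1.
have head n c : nth point (glued_directive hd L n c) 0 = c by exact: head_glued.
have mV n : measurable (V n) by exact: measurable_block_marker.
have VP n y q : (q < glued_len d L n)%N ->
    V n (iter q (@left_shift (Lambda hd)) (morph_bi (glued_directive hd L n) y)) <-> q = 0%N.
  exact: block_markerP.
have m_inv n : invariant_measure (@left_shift (Lambda hd)) (mun i n) := (Hmun i n).1.1.
have m_step := pr_induced_step szS (fun n => ltnW (len1 n)) head finA mV VP (Hmun i).
have out0 := outside_cvg0 (Hlim i).
have M5 : (5 <= M)%N := zeta_base_ge5 hL i.
have /andP[r0 r1] := @rho1_bounds _ M5 R.
pose delta : R := (1 + rho1 M) / 2.
have deltaE : (M%:R - 1) / (M%:R + 1) = delta.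
  have M0 : 0 <= M%:R :> R by [].
  by rewrite /delta /rho1; field; rewrite ?andbT; apply/lt0r_neq0; lra.
have prc : partial_rigidity_constant (@left_shift (Lambda hd)) (mu i)
    (height (glued_directive hd L)) delta.
  apply: (height_rigidity_constant szS len1 finA (Hmu i).1.1 (Hmun i)).
    by rewrite /delta; apply/andP; split; lra.
  exact: repeat_ge_rho1.
have ub f delta' : partial_rigidity_constant (@left_shift (Lambda hd)) (mu i) f delta' ->
    delta' <= delta.
  move=> Hf; apply/ler_addgt0Pr => e e0.
  (* A single level [N] is enough for a given [e]: the match probability there is at most
     [(1 + rho1 M + e) / 2], below [delta + e]. *)
  have [N /(_ N (leqnn N)) HN] := match_letter_le hL m_inv m_step out0 e0.
  apply: (rigidity_constant_le szS len1 head finA mV VP (Hmun i) (n := N)) Hf.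
    by rewrite /delta; lra.
  move=> k /HN; rewrite /match_letter ler_norml => /andP[_].
  rewrite -/M /delta; lra.
have -> : partial_rigidity_rate (@left_shift (Lambda hd)) (mu i) = delta.
  (* The supremum is attained: [delta] is a constant along the heights and bounds all the others. *)
  apply/eqP; rewrite eq_le; apply/andP; split.
    by apply: ge_sup => [|x [f /ub]//]; exists delta, (height (glued_directive hd L)).
  apply: ub_le_sup; first by exists delta => x [f /ub].
  by exists (height (glued_directive hd L)).
by split.
Qed.
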